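(* Let $v\in W$, let $v=s_{i_1}\cdots s_{i_l}$ be a decomposition of $v$ into simple reflections, not necessarily reduced, and put $\beta_j=s_{i_1}\cdots s_{i_{j-1}}\alpha_{i_j}$ for $1\le j\le l$. If $w\in W$ satisfies $w\le v$, then $$\psi^w(v)=e^{\rho-v\rho}\sum_{l(w)\le m\le l}\ \sum(e^{-\beta_{j_1}}-1)\cdots(e^{-\beta_{j_m}}-1),$$ where the second sum runs over the integers $1\le j_1<\cdots<j_m\le l$ such that $\underline{s_{i_{j_1}}}\cdots\underline{s_{i_{j_m}}}=\underline w$ in the monoid $\underline W$.
   Context: Kac–Moody setting. $A=(a_{ij})_{1\le i,j\le r}$ is a generalized Cartan matrix, $(\mathfrak h,\{\alpha_i\},\{h_i\})$ a realization over $\mathbb C$ ($\alpha_j(h_i)=a_{ij}$), $\mathfrak g$ the Kac–Moody algebra, $W$ its Weyl group generated by $s_i(\lambda)=\lambda-\lambda(h_i)\alpha_i$ on $\mathfrak h^*$, with length $l(\cdot)$, Bruhat order $\le$ and identity $1$. A lattice $\mathfrak h_{\mathbb Z}\subset\mathfrak h$ is fixed with $\mathfrak h_{\mathbb Z}\otimes\mathbb C=\mathfrak h$, $h_i\in\mathfrak h_{\mathbb Z}$, $\mathfrak h_{\mathbb Z}/\sum\mathbb Zh_i$ torsion free, $\alpha_i\in\mathfrak h_{\mathbb Z}^*=\mathrm{Hom}(\mathfrak h_{\mathbb Z},\mathbb Z)$; fundamental weights $\rho_i\in\mathfrak h_{\mathbb Z}^*$ satisfy $\rho_i(h_j)=\delta_{i,j}$,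 and $\rho=\sum_i\rho_i$. $G$ is the Kac–Peterson group of $\mathfrak g$, $B\supset H$ its standard Borel and Cartan subgroups, $K$ the standard unitary form, $T=K\cap H$, $X=G/B=K/T$ with left $T$-action, $X^T$ identified with $W$. $R[T]=\mathbb Z[X[T]]$ is the group ring of the characters of $T$, $Q[T]$ its fraction field, $e^\lambda$ the character of an integral weight $\lambda$. The monoid $\underline W$ is generated by $\underline{s_1},\dots,\underline{s_r}$ with the relations $\underline{s_i}^2=\underline{s_i}$ and the braid relations of $W$. For $w\in W$ with reduced decomposition $w=s_{i_1}\cdots s_{i_k}$ put $\underline w=\underline{s_{i_1}}\cdots\underline{s_{i_k}}$; $w\mapsto\underline w$ is a bijection $W\to\underline W$. The functions $\psi^w$. On $F(W;Q[T])$ (functions $W\to Q[T]$) define $(D_if)(v)=\dfrac{f(v)-f(vs_i)e^{-v\alpha_i}}{1-e^{-v\alpha_i}}$; these satisfy the braid relations, so $D_w=D_{i_1}\cdots D_{i_k}$ is well defined for a reduced decomposition $w=s_{i_1}\cdots s_{i_k}$. Let $\Psi=\{f\in F(W;R[T]):D_wf\in F(W;R[T])\ \forall w\in W\}$. By Kostant–Kumar, restriction to fixed points $i_T^*$ is an isomorphism of $K_T(X)$ onto $\Psi$, and $\Psi=\prod_{w\in W}R[T]\psi^w$, where the $\psi^w\in\Psi$ are uniquely determined by $D_v(\psi^w)(1)=\delta_{v,w}$ for all $v,w\in W$. (Here $K_T(X)=\varprojlim_nK_T(X_n)$, $X_n=\bigcup_{l(w)\le n}BwB/B$.) An empty product (case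 $m=0$) equals $1$. *)

(* Defs.v *)
From HB Require Import structures.
From Stdlib Require Import Relation_Operators.
From mathcomp Require Import all_boot all_order all_algebra.
From mathcomp Require Import finmap complex monalg.
From mathcomp Require Import boolp reals.

Set Implicit Arguments.
Unset Strict Implicit.
Unset Printing Implicit Defensive.

Import Order.TTheory GRing.Theory Num.Theory.
Local Open Scope fset_scope.
Local Open Scope quotient_scope.
Local Open Scope ring_scope.

(* [monalg] only equips [{malg _[K]}] with a product when [K] has no nontrivial
   invertible element, which excludes groups. *)
Definition group_ring (X : zmodType) : Type := {malg int[X]}.

Section GroupRing.
Variable X : zmodType.

HB.instance Definition _ := Choice.copy (group_ring X) {malg int[X]}.
HB.instance Definition _ := GRing.Zmodule.copy (group_ring X) {malg int[X]}.

Implicit Types (g : group_ring X) (x y : X).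

Definition gr_exp x : group_ring X := << x >>.

Definition gr_mul g1 g2 : group_ring X :=
  \sum_(x <- msupp g1) \sum_(y <- msupp g2) << g1@_x * g2@_y *g x + y >>.

Lemma gr_mulw (d1 d2 : {fset X}) g1 g2 :
  msupp g1 `<=` d1 -> msupp g2 `<=` d2 ->
  gr_mul g1 g2 = \sum_(x <- d1) \sum_(y <- d2) << g1@_x * g2@_y *g x + y >>.
Proof.
move=> le_d1 le_d2; rewrite /gr_mul (big_fset_incl _ le_d1) /=.
  apply/eq_bigr=> k1 _; apply/big_fset_incl => // k _ /mcoeff_outdom ->.
  by rewrite mulr0 monalgU0.
move=> k _ /mcoeff_outdom g1k.
by rewrite big1 => // k' _; rewrite g1k mul0r monalgU0.
Qed.

Lemma gr_mulC : commutative gr_mul.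
Proof.
move=> g1 g2; rewrite /gr_mul exchange_big /=.
by apply: eq_bigr => y _; apply: eq_bigr => x _; rewrite addrC mulrC.
Qed.

Lemma gr_mulDl : left_distributive gr_mul +%R.
Proof.
move=> g1 g2 g.
rewrite [in RHS](gr_mulw (fsubsetUl _ (msupp g2)) (fsubset_refl _)).
rewrite [in RHS](gr_mulw (fsubsetUr (msupp g1) _) (fsubset_refl _)).
rewrite (gr_mulw (msuppD_le _ _) (fsubset_refl _)).
rewrite -big_split /=; apply/eq_bigr=> k1 _.
rewrite -big_split /=; apply/eq_bigr=> k2 _.
by rewrite mcoeffD mulrDl monalgUD.
Qed.

Lemma gr_mul0 : left_zero 0 gr_mul.
Proof. by move=> g; rewrite /gr_mul msupp0 big_seq_fset0. Qed.

Lemma gr_mulUU (c1 c2 : int) x y :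
  gr_mul << c1 *g x >> << c2 *g y >> = << c1 * c2 *g x + y >>.
Proof. by rewrite (gr_mulw msuppU_le msuppU_le) !big_seq_fset1 !mcoeffUU. Qed.

Lemma gr_mul1 : left_id (gr_exp 0) gr_mul.
Proof.
move=> g; rewrite (gr_mulw msuppU_le (fsubset_refl _)) big_seq_fset1.
rewrite [RHS]monalgE; apply/eq_bigr=> k _.
by rewrite mcoeffUU mul1r add0r.
Qed.

Lemma gr_mul_suml (I : Type) (s : seq I) (F : I -> group_ring X) g :
  gr_mul (\sum_(i <- s) F i) g = \sum_(i <- s) gr_mul (F i) g.
Proof. exact: (big_morph (gr_mul^~ g) (fun _ _ => gr_mulDl _ _ _) (gr_mul0 g)). Qed.

Lemma gr_mulA : associative gr_mul.
Proof.
have mul_sumr (I : Type) (s : seq I) (F : I -> group_ring X) g :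
    gr_mul g (\sum_(i <- s) F i) = \sum_(i <- s) gr_mul g (F i).
  by rewrite gr_mulC gr_mul_suml; apply: eq_bigr => i _; rewrite gr_mulC.
move=> g1 g2 g3.
rewrite [g1]monalgE (gr_mul_suml _ _ (gr_mul g2 g3)) (gr_mul_suml _ _ g2).
rewrite (gr_mul_suml _ _ g3); apply: eq_bigr => x _.
rewrite [g2]monalgE (gr_mul_suml _ _ g3) (mul_sumr _ _ _ << g1@_x *g x >>).
rewrite (mul_sumr _ _ _ << g1@_x *g x >>) (gr_mul_suml _ _ g3).
apply: eq_bigr => y _; rewrite [g3]monalgE (mul_sumr _ _ _ << g2@_y *g y >>).
rewrite (mul_sumr _ _ _ << g1@_x *g x >>) (mul_sumr _ _ _ (gr_mul _ _)).
apply: eq_bigr => z _.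
by rewrite !gr_mulUU mulrA addrA.
Qed.

Lemma gr_1_neq0 : gr_exp 0 != 0 :> group_ring X.
Proof. by apply/eqP/malgP=> /(_ 0) /eqP; rewrite mcoeffUU mcoeff0 oner_eq0. Qed.

HB.instance Definition _ := GRing.Zmodule_isComNzRing.Build (group_ring X)
  gr_mulA gr_mulC gr_mul1 gr_mulDl gr_1_neq0.

Lemma gr_expD x y : gr_exp (x + y) = gr_exp x * gr_exp y.
Proof. by rewrite [RHS]gr_mulUU mul1r. Qed.

Lemma gr_exp_inj : injective gr_exp.
Proof.
move=> x y /malgP/(_ y); rewrite mcoeffUU mcoeffU.
by case: eqP => // _ /eqP; rewrite eq_sym oner_eq0.
Qed.

Lemma mcoeff_mul g1 g2 z :
  (g1 * g2)@_z = \sum_(x <- msupp g1) \sum_(y <- msupp g2)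
                   (g1@_x * g2@_y) *+ (x + y == z).
Proof.
rewrite [g1 * g2]/(gr_mul g1 g2) raddf_sum; apply: eq_bigr => x _.
by rewrite raddf_sum; apply: eq_bigr => y _; exact: mcoeffU.
Qed.

Definition gr_unit : {pred group_ring X} :=
  [pred g | `[< exists g', g' * g = 1 >]].
Definition gr_inv g : group_ring X :=
  if pselect (exists g', g' * g = 1) is left ex then projT1 (cid ex) else g.

Fact gr_mulVg : {in gr_unit, left_inverse 1 gr_inv *%R}.
Proof.
move=> g /asboolP ex; rewrite /gr_inv; case: pselect => // ex'.
exact: projT2 (cid ex').
Qed.
Fact gr_unitP g g' : g' * g = 1 -> gr_unit g.
Proof. by move=> gg'; apply/asboolP; exists g'. Qed.
Fact gr_inv_out : {in [predC gr_unit], gr_inv =1 id}.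
Proof.
by move=> g /asboolPn nex; rewrite /gr_inv; case: pselect.
Qed.

HB.instance Definition _ := GRing.ComNzRing_hasMulInverse.Build (group_ring X)
  gr_mulVg gr_unitP gr_inv_out.

(* [P] is the positive cone of a translation-invariant total order on [X]. *)
Lemma group_ring_integral (P : X -> Prop) :
    ~ P 0 -> (forall x y, P x -> P y -> P (x + y)) ->
    (forall x, [\/ x = 0, P x | P (- x)]) ->
  forall g1 g2, g1 * g2 = 0 -> (g1 == 0) || (g2 == 0).
Proof.
move=> P0 PD Ptri.
have max_ex (s : seq X) x0 : exists2 m, m \in x0 :: s &
    forall y, y \in x0 :: s -> y = m \/ P (m - y).
  elim: s x0 => [|x1 s IHs] x0.
    by exists x0; rewrite ?mem_head // => y; rewrite inE => /eqP; left.
  have [m m_s m_max] := IHs x1; case: (Ptri (m - x0)) => [/subr0_eq e|pos|neg].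
  - exists m; first by rewrite in_cons m_s orbT.
    by move=> y; rewrite in_cons => /predU1P[->|/m_max //]; left; rewrite e.
  - exists m; first by rewrite in_cons m_s orbT.
    by move=> y; rewrite in_cons => /predU1P[->|/m_max //]; right.
  - exists x0; first by rewrite mem_head.
    move=> y; rewrite in_cons => /predU1P[->|/m_max]; first by left.
    rewrite opprB in neg; case=> [->|my]; right=> //.
    by rewrite -(subrK m x0) -addrA; apply: PD.
have lead g : g != 0 -> exists2 m, m \in msupp g &
    forall y, y \in msupp g -> y = m \/ P (m - y).
  move=> nz_g; case E: (enum_fset (msupp g)) => [|x0 s].
    case/eqP: nz_g; rewrite [g]monalgE.
    by rewrite (_ : msupp g = fset0) ?big_seq_fset0 //; apply/fsetP=> x;
      rewrite inE; have: x \in enum_fset (msupp g) = false by rewrite E.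
  have [m m_s m_max] := max_ex s x0.
  have memE y : (y \in msupp g) = (y \in x0 :: s) by rewrite -E.
  by exists m => [|y]; rewrite memE //; apply: m_max.
move=> g1 g2 g12; apply/norP=> -[/lead[m1 m1g max1] /lead[m2 m2g max2]].
have: (g1 * g2)@_(m1 + m2) = g1@_m1 * g2@_m2.
  rewrite mcoeff_mul (big_fsetD1 m1) //= (big_fsetD1 m2) //= eqxx mulr1n.
  rewrite big_seq big1 => [|y]; last first.
    rewrite in_fsetD1 => /andP[ne _]; case: eqP => // /addrI e.
    by rewrite e eqxx in ne.
  rewrite addr0 big_seq big1 ?addr0 // => x; rewrite in_fsetD1 => /andP[nx xg].
  rewrite big_seq big1 // => y yg; case: eqP => // e.
  case: (max1 x xg) => [ex|px]; first by rewrite ex eqxx in nx.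
  case: (max2 y yg) => [ey|py].
    by case/eqP: nx; apply: (@addIr _ m2); rewrite -{1}ey.
  case: P0; have := PD _ _ px py.
  by rewrite addrACA -opprD e subrr.
rewrite g12 mcoeff0 => /esym/eqP; rewrite mulf_eq0 !mcoeff_eq0.
by rewrite m1g m2g.
Qed.

End GroupRing.

Record gcm (r : nat) := GCM {
  gcm_mx :> 'M[int]_r;
  gcm_diag : forall i, gcm_mx i i = 2;
  gcm_offdiag : forall i j, i != j -> gcm_mx i j <= 0;
  gcm_eq0 : forall i j, gcm_mx i j = 0 -> gcm_mx j i = 0 }.

Definition integral_on (R : realType) (h : vectType R[i]) (L : {pred h})
    (f : 'Hom(h, R[i]^o)) : Prop :=
  forall x, x \in L -> exists z : int, f x = z%:~R.

Definition zspan (V : zmodType) (n : nat) (b : 'I_n -> V) (x : V) : Prop :=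
  exists c : 'I_n -> int, x = \sum_k b k *~ c k.

Record realization (R : realType) (r : nat) (A : gcm r) := Realization {
  cartan : vectType R[i];
  coroot : 'I_r -> cartan;
  simple_root : 'I_r -> 'Hom(cartan, R[i]^o);
  coroot_free : free [tuple coroot i | i < r];
  root_free : free [tuple simple_root i | i < r];
  root_coroot : forall i j, simple_root j (coroot i) = (A i j)%:~R;
  dim_cartan :
    (\dim {:cartan} + \rank (map_mx intr A : 'M[R[i]]_r) = r + r)%N;
  (* a lattice L with L (x) C = h is the Z-span of a C-basis of h *)
  lattice : {pred cartan};
  latticeP : exists2 b : (\dim {:cartan}).-tuple cartan, basis_of fullv b &
    forall x, x \in lattice <-> zspan (tnth b) x;
  coroot_lattice : forall i, coroot i \in lattice;
  lattice_torsion_free : forall (n : int) x, n != 0 -> x \in lattice ->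
    zspan coroot (x *~ n) -> zspan coroot x;
  root_integral : forall i, integral_on lattice (simple_root i);
  fundwt : 'I_r -> 'Hom(cartan, R[i]^o);
  fundwt_integral : forall i, integral_on lattice (fundwt i);
  fundwt_coroot : forall i j, fundwt i (coroot j) = (i == j)%:R }.

Arguments coroot {R r A} D i : rename.
Arguments simple_root {R r A} D i : rename.
Arguments lattice {R r A} D : rename.
Arguments fundwt {R r A} D i : rename.
Arguments coroot_lattice {R r A} D i : rename.
Arguments root_integral {R r A} D i : rename.
Arguments fundwt_integral {R r A} D i : rename.

Section KacMoody.
Variables (R : realType) (r : nat) (A : gcm r) (D : realization R A).

Local Notation V := 'Hom(cartan D, R[i]^o).

(* Since the lattice spans the Cartan subalgebra, Hom(L, Z), the character group
   of the torus, is the group of linear forms that are integral on L. *)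
Definition integral_wt : {pred V} := [pred f | `[< integral_on (lattice D) f >]].

Fact integral_wt_closed : zmod_closed integral_wt.
Proof.
split=> [|f g /asboolP fP /asboolP gP]; apply/asboolP => x xL.
  by exists 0; rewrite lfunE.
have [[z ez] [t et]] := (fP x xL, gP x xL).
by exists (z - t); rewrite !lfunE /= lfunE /= ez et intrB.
Qed.
HB.instance Definition _ :=
  GRing.isZmodClosed.Build V integral_wt integral_wt_closed.

Definition weight : Type := {f : V | integral_wt f}.
HB.instance Definition _ := SubChoice.on weight.
HB.instance Definition _ := [SubChoice_isSubZmodule of weight by <:].

Definition root_wt i : weight :=
  Sub (simple_root D i) (introT (asboolP _) (root_integral D i)).
Definition fund_wt i : weight :=
  Sub (fundwt D i) (introT (asboolP _) (fundwt_integral D i)).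
Definition rho : weight := \sum_i fund_wt i.

(* R[T] and its fraction field Q[T] *)
Definition RT : Type := group_ring weight.
HB.instance Definition _ := GRing.ComUnitRing.on RT.

Fact RT_integral : GRing.integral_domain_axiom RT.
Proof.
have [b bbasis bP] := latticeP D; set n := \dim _ in b bbasis bP.
have bL k : tnth b k \in lattice D.
  apply/bP; exists (fun j => (j == k)%:Z); rewrite (bigD1 k) //= eqxx big1 ?addr0 //.
  by move=> j /negPf ->.
pose P (x : weight) := exists2 k : 'I_n, 0 < val x (tnth b k) &
   forall j : 'I_n, (j < k)%N -> val x (tnth b j) = 0.
have valD (x y : weight) u : val (x + y) u = val x u + val y u.
  by rewrite raddfD lfunE.
have valN (x : weight) u : val (- x) u = - val x u by rewrite raddfN lfunE.
apply: (@group_ring_integral weight P).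
- by case=> k; rewrite raddf0 lfunE /= ltxx.
- move=> x y [k xk xlt] [l yl ylt]; case: (ltngtP k l) => [kl|lk|/val_inj kl].
  + exists k; first by rewrite valD (ylt k kl) addr0.
    by move=> j jk; rewrite valD xlt // ylt ?addr0 // (ltn_trans jk).
  + exists l; first by rewrite valD (xlt l lk) add0r.
    by move=> j jl; rewrite valD ylt // xlt ?addr0 // (ltn_trans jl).
  + exists k; first by rewrite valD addr_gt0 // kl.
    by move=> j jk; rewrite valD xlt // ylt ?addr0 // -kl.
- move=> x; have [nz|] := pselect (exists k, val x (tnth b k) != 0); last first.
    move=> all0; constructor 1; apply: val_inj; rewrite raddf0.
    apply/lfunP => u; rewrite [RHS]lfunE /=.
    have := memvf u; rewrite -(span_basis bbasis) => /coord_span ->.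
    rewrite linear_sum big1 // => k _; rewrite linearZ /=.
    rewrite (_ : val x b`_k = 0) ?scaler0 //; apply/eqP/negPn/negP => nz.
    by apply: all0; exists k; rewrite (tnth_nth 0).
  have exn : exists m, [exists k : 'I_n, (val k == m) && (val x (tnth b k) != 0)].
    by case: nz => k nz; exists (val k); apply/existsP; exists k; rewrite eqxx.
  case: (ex_minnP exn) => m /existsP[k /andP[/eqP <- nzk]] minm {exn nz}.
  have lt0 (j : 'I_n) : (j < k)%N -> val x (tnth b j) = 0.
    move=> jk; apply/eqP; apply: contraTT jk => nzj; rewrite -leqNgt.
    by apply: minm; apply/existsP; exists j; rewrite eqxx.
  have [z zE] := asboolW (valP x) _ (bL k).
  rewrite zE intr_eq0 in nzk; case: (ltgtP z 0) nzk => // zs _.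
  + constructor 3; exists k; first by rewrite valN zE oppr_gt0 ltrz0.
    by move=> j /lt0 e; rewrite valN e oppr0.
  + by constructor 2; exists k; rewrite // zE ltr0z.
Qed.
HB.instance Definition _ := GRing.ComUnitRing_isIntegral.Build RT RT_integral.

Definition QT : Type := {fraction RT}.
HB.instance Definition _ := GRing.Field.on QT.

Definition expwt (x : weight) : QT := tofrac (gr_exp x : RT).

Lemma expwt0 : expwt 0 = 1.
Proof. exact: rmorph1. Qed.

Lemma expwtD x y : expwt (x + y) = expwt x * expwt y.
Proof. by rewrite /expwt gr_expD rmorphM. Qed.

Lemma expwt_inj : injective expwt.
Proof. by move=> x y /eqP; rewrite tofrac_eq => /eqP/gr_exp_inj. Qed.

Definition srefl_fun i (f : V) : V := f - f (coroot D i) *: simple_root D i.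
Fact srefl_linear i : linear (srefl_fun i).
Proof.
move=> a f g; rewrite /srefl_fun !lfunE /= lfunE /= scalerBr scalerDl scalerA.
by rewrite opprD addrACA.
Qed.
HB.instance Definition _ i :=
  GRing.isLinear.Build _ _ _ _ (srefl_fun i) (srefl_linear i).
Definition srefl i : 'End(V) := linfun (srefl_fun i).

Definition word_lfun (s : seq 'I_r) : 'End(V) :=
  foldr (fun i f => (srefl i \o f)%VF) \1%VF s.

Definition in_weyl : {pred 'End(V)} :=
  [pred f | `[< exists s, f = word_lfun s >]].
Definition weyl : Type := {f : 'End(V) | in_weyl f}.
HB.instance Definition _ := SubChoice.on weyl.

Fact word_lfun_cat s t : word_lfun (s ++ t) = (word_lfun s \o word_lfun t)%VF.
Proof.
by elim: s => [|i s IHs] /=; rewrite ?comp_lfun1l // IHs comp_lfunA.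
Qed.

Fact sreflK i : (srefl i \o srefl i = \1)%VF.
Proof.
apply/lfunP=> f; rewrite !lfunE /= !lfunE /= /srefl_fun.
rewrite add_lfunE opp_lfunE scale_lfunE root_coroot gcm_diag.
rewrite (_ : _ *: 2%:~R = f (coroot D i) + f (coroot D i)); last exact: mulr_natr.
by rewrite opprD addNKr scaleNr opprK subrK.
Qed.

Fact word_lfunK s : (word_lfun (rev s) \o word_lfun s = \1)%VF.
Proof.
elim: s => [|i s IHs]; first by rewrite comp_lfun1l.
rewrite rev_cons -cats1 word_lfun_cat /= comp_lfun1r -comp_lfunA.
by rewrite [(srefl i \o (_ \o _))%VF]comp_lfunA sreflK comp_lfun1l.
Qed.

Fact in_weyl_word s : in_weyl (word_lfun s).
Proof. by apply/asboolP; exists s. Qed.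

Fact in_weyl_comp (u w : weyl) : in_weyl (val u \o val w)%VF.
Proof.
case: u w => [u /= /asboolP[s ->]] [w /= /asboolP[t ->]].
by rewrite -word_lfun_cat in_weyl_word.
Qed.

Fact in_weyl_inv_ex (w : weyl) : exists u : weyl, (val u \o val w = \1)%VF.
Proof.
case: w => [w /= /asboolP[s ->]].
by exists (Sub _ (in_weyl_word (rev s))); rewrite word_lfunK.
Qed.

Definition weyl_one : weyl := Sub \1%VF (in_weyl_word [::]).
Definition weyl_mul (u w : weyl) : weyl := Sub _ (in_weyl_comp u w).
Definition weyl_inv (w : weyl) : weyl := projT1 (cid (in_weyl_inv_ex w)).

Fact weyl_mulA : associative weyl_mul.
Proof. by move=> u v w; apply: val_inj; rewrite /= comp_lfunA. Qed.
Fact weyl_mul1 : left_id weyl_one weyl_mul.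
Proof. by move=> w; apply: val_inj; rewrite /= comp_lfun1l. Qed.
Fact weyl_1mul : right_id weyl_one weyl_mul.
Proof. by move=> w; apply: val_inj; rewrite /= comp_lfun1r. Qed.
Fact weyl_mulV : left_inverse weyl_one weyl_inv weyl_mul.
Proof. by move=> w; apply: val_inj; exact: (projT2 (cid (in_weyl_inv_ex w))). Qed.
Fact weyl_Vmul : right_inverse weyl_one weyl_inv weyl_mul.
Proof.
move=> w; rewrite -[LHS]weyl_mul1 -(weyl_mulV (weyl_inv w)) -weyl_mulA.
by rewrite [weyl_mul (weyl_inv w) _]weyl_mulA weyl_mulV weyl_mul1.
Qed.
HB.instance Definition _ := isGroup.Build weyl
  weyl_mulA weyl_mul1 weyl_1mul weyl_mulV weyl_Vmul.

Definition sgen i : weyl := Sub (word_lfun [:: i]) (in_weyl_word [:: i]).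

Definition word_weyl (s : seq 'I_r) : weyl := (\prod_(i <- s) sgen i)%g.

Fact val_word_weyl s : val (word_weyl s) = word_lfun s.
Proof.
rewrite /word_weyl; elim: s => [|i s IHs]; first by rewrite big_nil.
by rewrite big_cons /= comp_lfun1r IHs.
Qed.

Fact integral_srefl i f : integral_wt f -> integral_wt (srefl i f).
Proof.
move=> fP; have [z zE] := asboolW fP _ (coroot_lattice D i).
apply/asboolP => x xL; have [a aE] := asboolW fP _ xL.
have [c cE] := root_integral D i _ xL.
exists (a - z * c); rewrite lfunE /= /srefl_fun add_lfunE opp_lfunE scale_lfunE.
by rewrite zE aE cE intrB intrM.
Qed.

Fact integral_weyl (w : weyl) (x : weight) : integral_wt (val w (val x)).
Proof.
case: w => [w /= /asboolP[s ->]]; elim: s => [|i s IHs] /=.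
  by rewrite id_lfunE (valP x).
by rewrite comp_lfunE /=; apply: integral_srefl.
Qed.

Definition weyl_act (w : weyl) (x : weight) : weight := Sub _ (integral_weyl w x).

Fact weyl_word_ex (w : weyl) :
  exists n, [exists s : n.-tuple 'I_r, word_weyl s == w].
Proof.
case: w => w wP; have /asboolP[s wE] := wP.
exists (size s); apply/existsP; exists (in_tuple s).
by apply/eqP/val_inj; rewrite val_word_weyl /= wE.
Qed.

Definition len (w : weyl) : nat := ex_minn (weyl_word_ex w).

Fact redword_ex (w : weyl) :
  exists s : (len w).-tuple 'I_r, word_weyl s == w.
Proof. by rewrite /len; case: ex_minnP => n /existsP. Qed.

(* A chosen reduced decomposition. What is built on it below ([dem_weyl], [opDw])
   does not depend on the choice, by the braid relations. *)
Definition redword (w : weyl) : seq 'I_r := xchoose (redword_ex w).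

Definition reflection (t : weyl) : Prop :=
  exists w i, t = (w * sgen i * w^-1)%g.

Definition bruhat : weyl -> weyl -> Prop :=
  clos_refl_trans weyl (fun u w =>
    exists t, [/\ reflection t, w = (u * t)%g & (len u < len w)%N]).

(* i j i j ... with m letters *)
Definition alt_word (m : nat) (i j : 'I_r) : seq 'I_r :=
  [seq if odd k then j else i | k <- iota 0 m].

Definition has_order (x : weyl) (m : nat) : Prop :=
  [/\ (0 < m)%N, (x ^+ m)%g = 1%g &
      forall k, (0 < k < m)%N -> (x ^+ k)%g <> 1%g].

(* The presentation of the monoid with idempotent generators satisfying the
   braid relations of the Weyl group. *)
Inductive dem_cong : seq 'I_r -> seq 'I_r -> Prop :=
| dem_idem i : dem_cong [:: i; i] [:: i]
| dem_braid i j m : i != j -> has_order (sgen i * sgen j)%g m ->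
    dem_cong (alt_word m i j) (alt_word m j i)
| dem_refl s : dem_cong s s
| dem_sym s t : dem_cong s t -> dem_cong t s
| dem_trans s t u : dem_cong s t -> dem_cong t u -> dem_cong s u
| dem_cat s s' t t' : dem_cong s s' -> dem_cong t t' ->
    dem_cong (s ++ t) (s' ++ t').

Definition dem_rel : rel (seq 'I_r) := fun s t => `[< dem_cong s t >].

Fact dem_equiv_class : equiv_class_of dem_rel.
Proof.
split=> [s|s t|t s u]; first exact/asboolP/dem_refl.
- by apply/asboolP/asboolP; apply: dem_sym.
- by move=> /asboolP st /asboolP tu; apply/asboolP; apply: dem_trans tu.
Qed.
Canonical dem_equiv := EquivRelPack dem_equiv_class.

Definition dem_monoid : Type := {eq_quot dem_equiv}.
HB.instance Definition _ := Choice.on dem_monoid.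

Definition dem_class (s : seq 'I_r) : dem_monoid := \pi s.
Definition dem_mul (x y : dem_monoid) : dem_monoid :=
  dem_class (repr x ++ repr y).

Fact dem_classP s t : dem_class s = dem_class t <-> dem_cong s t.
Proof.
by split=> [/eqquotP/asboolP | st]; last by apply/eqquotP/asboolP.
Qed.

Fact dem_classM s t : dem_mul (dem_class s) (dem_class t) = dem_class (s ++ t).
Proof. by apply/dem_classP; apply: dem_cat; apply/dem_classP; apply: reprK. Qed.

Fact dem_mulA : associative dem_mul.
Proof.
elim/quotW=> s; elim/quotW=> t; elim/quotW=> u.
by rewrite -![\pi _]/(dem_class _) !dem_classM catA.
Qed.
Fact dem_mul1 : left_id (dem_class [::]) dem_mul.
Proof. by elim/quotW=> s; rewrite -[\pi s]/(dem_class s) dem_classM. Qed.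
Fact dem_1mul : right_id (dem_class [::]) dem_mul.
Proof. by elim/quotW=> s; rewrite -[\pi s]/(dem_class s) dem_classM cats0. Qed.
HB.instance Definition _ :=
  isMonoid.Build dem_monoid dem_mulA dem_mul1 dem_1mul.

Definition dgen i : dem_monoid := dem_class [:: i].

Definition dem_weyl (w : weyl) : dem_monoid := (\prod_(i <- redword w) dgen i)%g.

(* [e] is e^{-v alpha_i} *)
Definition opD i (f : weyl -> QT) : weyl -> QT := fun v =>
  let e := expwt (- weyl_act v (root_wt i)) in
  (f v - f (v * sgen i)%g * e) / (1 - e).

Definition opDw (w : weyl) (f : weyl -> QT) : weyl -> QT :=
  foldr opD f (redword w).

Definition RT_valued (f : weyl -> QT) : Prop :=
  forall v, exists a : RT, f v = tofrac a.

Definition in_Psi (f : weyl -> QT) : Prop :=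
  RT_valued f /\ forall w, RT_valued (opDw w f).

(* The conditions determine [psi w] uniquely, for each [w]. *)
Definition is_psi (psi : weyl -> weyl -> QT) : Prop :=
  forall w, in_Psi (psi w) /\ forall v, opDw v (psi w) 1%g = (v == w)%:R.

(* beta_j = s_{i_1} ... s_{i_(j-1)} alpha_{i_j}, with positions numbered from 0 *)
Definition beta l (s : l.-tuple 'I_r) (j : 'I_l) : weight :=
  weyl_act (word_weyl (take j s)) (root_wt (tnth s j)).

End KacMoody.

(* Main.v *)
Require Import Defs.
From mathcomp Require Import all_boot all_order all_algebra.
From mathcomp Require Import complex reals boolp ring zify.

Set Implicit Arguments.
Unset Strict Implicit.
Unset Printing Implicit Defensive.

Import Order.TTheory GRing.Theory Num.Theory.
Local Open Scope ring_scope.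

(** Solving the definition of [D_i] for the translated value gives
      [f (u s_i) = e^{u alpha_i} (f u + (e^{- u alpha_i} - 1) (D_i f) u)].
    Iterating along the word of [v] writes [f v] as [e^{rho - v rho}] times the
    sum, over all subwords, of the products of the [e^{- beta_j} - 1] with
    [(D_subword f) 1].  The [D_i] are idempotent and satisfy the braid
    relations, so [D_subword] depends only on the class of the subword in the
    monoid.  That class is the class of a reduced word of some [u], by the
    theorem of Matsumoto, and for [f = psi^w] the last factor is [1] if
    [u = w] and [0] otherwise.

    Both the braid relations of the [D_i] and the Coxeter property of [W]
    reduce to rank two: the braid relations are identities between rational
    functions in two variables, one for each of the orders 2, 3, 4, 6 of
    [s_i s_j], and the sign of [w alpha_i] is read off a factorization
    [w = w' u] with [u] in the subgroup generated by [s_i] and [s_j] and [w']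
    of minimal length. *)

(** * Demazure averages in rank two *)

(** Abstract form of $D_i$: [s] plays right translation by $s_i$ and [d x] plays $e^{-x\alpha_i}$,
    so identities between such operators become identities in a field. *)
Definition dem_avg (K : fieldType) (T : Type) (s : T -> T) (d : T -> K)
  (f : T -> K) (x : T) : K := (f x - f (s x) * d x) / (1 - d x).

(** Passing from [x] to [s x] multiplies numerator and denominator by the same factor $-1/d(x)$. *)
Lemma dem_avg_invariant (K : fieldType) (T : Type) (s : T -> T) (d : T -> K) :
    involutive s -> (forall x, d x != 0) -> (forall x, 1 - d x != 0) ->
    (forall x, d (s x) = (d x)^-1) ->
  forall f x, dem_avg s d f (s x) = dem_avg s d f x.
Proof.
move=> sK d0 d1 ds f x; rewrite /dem_avg sK ds; field.
by rewrite d1 d0 -opprB oppr_eq0 d1.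
Qed.

Lemma dem_avg_idem (K : fieldType) (T : Type) (s : T -> T) (d : T -> K) :
    involutive s -> (forall x, d x != 0) -> (forall x, 1 - d x != 0) ->
    (forall x, d (s x) = (d x)^-1) ->
  forall f x, dem_avg s d (dem_avg s d f) x = dem_avg s d f x.
Proof.
move=> sK d0 d1 ds f x; rewrite {1}/dem_avg dem_avg_invariant //.
by field; rewrite d1.
Qed.

Lemma dem_avg_shift (K : fieldType) (T : Type) (s : T -> T) (d : T -> K) f x :
    d x != 0 -> 1 - d x != 0 ->
  f (s x) = (d x)^-1 * (f x + (d x - 1) * dem_avg s d f x).
Proof. by move=> d0 d1; rewrite /dem_avg; field; rewrite d0 d1. Qed.

Section RankTwoBraid.
(** Model of two simple reflections: [b] and [c] stand for $-a_{ij}$ and $-a_{ji}$, and [de1] for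
    the independence of the two simple roots. *)
Variables (K : fieldType) (T : Type) (s t : T -> T) (d e : T -> K) (b c : nat).
Hypotheses (sK : involutive s) (tK : involutive t).
Hypotheses (d0 : forall x, d x != 0) (e0 : forall x, e x != 0).
Hypotheses (ds : forall x, d (s x) = (d x)^-1).
Hypotheses (et : forall x, e (t x) = (e x)^-1).
Hypotheses (es : forall x, e (s x) = e x * d x ^+ b).
Hypotheses (dt : forall x, d (t x) = d x * e x ^+ c).
Hypothesis de1 :
  forall x p q, (0 < p + q)%N -> 1 - d x ^+ p * e x ^+ q != 0.

Local Notation S := (dem_avg s d).
Local Notation U := (dem_avg t e).

Let d1 y : 1 - d y != 0.
Proof. by have := @de1 y 1%N 0%N isT; rewrite mulr1. Qed.
Let e1 y : 1 - e y != 0.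
Proof. by have := @de1 y 0%N 1%N isT; rewrite mul1r. Qed.
Let Ss g y : S g (s y) = S g y. Proof. exact: dem_avg_invariant. Qed.
Let Ut g y : U g (t y) = U g y. Proof. exact: dem_avg_invariant. Qed.
Let Sx g y : S g y = (g y - g (s y) * d y) / (1 - d y). Proof. by []. Qed.
Let Ux g y : U g y = (g y - g (t y) * e y) / (1 - e y). Proof. by []. Qed.

(* In each case the weights are first rewritten as monomials in [d x], [e x]
   with nonnegative exponents (the positive roots of the rank two system), so
   that every denominator is covered by [de1]. *)

Lemma dem_avg_braid2 : b = 0%N -> c = 0%N ->
    (forall x, s (t x) = t (s x)) ->
  forall f x, S (U f) x = U (S f) x.
Proof.
move=> b0 c0 st f x.
have es1 := es; have dt1 := dt; rewrite b0 in es1; rewrite c0 in dt1.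
rewrite !(Sx, Ux) st es1 dt1 !mulr1.
have := e1 x; have := d1 x; move: (d x) (e x) => X Y dx ex.
by field; rewrite ex dx.
Qed.

Lemma dem_avg_braid3 : b = 1%N -> c = 1%N ->
    (forall x, s (t (s x)) = t (s (t x))) ->
  forall f x, S (U (S f)) x = U (S (U f)) x.
Proof.
move=> b1 c1 st f x.
have es1 := es; have dt1 := dt; rewrite b1 in es1; rewrite c1 in dt1.
set X := d x; set Y := e x.
have h1 : e (s x) = X * Y by rewrite es1 mulrC.
have h2 : d (t (s x)) = Y by rewrite dt1 h1 ds -/X -/Y; field; rewrite d0.
have k1 : d (t x) = X * Y by rewrite dt1.
have k2 : e (s (t x)) = X by rewrite es1 k1 et -/X -/Y; field; rewrite e0.
(* Invariance removes repeated reflections, so only points of the dihedral orbit of [x] remain, and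
   [st] identifies the two paths to the farthest one. *)
rewrite !(Ss, Ut, Sx, Ux) st h1 h2 k1 k2 -/X -/Y.
have n p q : (0 < p + q)%N -> 1 - X ^+ p * Y ^+ q != 0 by exact: de1.
have [nX nY] : 1 - X != 0 /\ 1 - Y != 0 by split; [exact: d1|exact: e1].
clearbody X Y; field.
by rewrite nX nY (n 1%N 1%N).
Qed.

Lemma dem_avg_braid4 : b = 1%N -> c = 2 ->
    (forall x, s (t (s (t x))) = t (s (t (s x)))) ->
  forall f x, S (U (S (U f))) x = U (S (U (S f))) x.
Proof.
move=> b1 c2 st f x.
have es1 := es; have dt1 := dt; rewrite b1 in es1; rewrite c2 in dt1.
set X := d x; set Y := e x.
have h1 : e (s x) = X * Y by rewrite es1 mulrC.
have h2 : d (t (s x)) = X * Y ^+ 2.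
  by rewrite dt1 h1 ds -/X -/Y; field; rewrite d0.
have h3 : e (s (t (s x))) = Y.
  by rewrite es1 h2 et h1 -/X -/Y; field; rewrite d0 e0.
have k1 : d (t x) = X * Y ^+ 2 by rewrite dt1.
have k2 : e (s (t x)) = X * Y by rewrite es1 k1 et -/X -/Y; field; rewrite e0.
have k3 : d (t (s (t x))) = X.
  by rewrite dt1 k2 ds k1 -/X -/Y; field; rewrite d0 e0.
rewrite !(Ss, Ut, Sx, Ux) st h1 h2 h3 k1 k2 k3 -/X -/Y.
have n p q : (0 < p + q)%N -> 1 - X ^+ p * Y ^+ q != 0 by exact: de1.
have [nX nY] : 1 - X != 0 /\ 1 - Y != 0 by split; [exact: d1|exact: e1].
clearbody X Y; field.
by rewrite nX nY (n 1%N 1%N) // (n 1%N 2).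
Qed.

Lemma dem_avg_braid6 : b = 1%N -> c = 3 ->
    (forall x, s (t (s (t (s (t x))))) = t (s (t (s (t (s x)))))) ->
  forall f x, S (U (S (U (S (U f))))) x = U (S (U (S (U (S f))))) x.
Proof.
move=> b1 c3 st f x.
have es1 := es; have dt1 := dt; rewrite b1 in es1; rewrite c3 in dt1.
set X := d x; set Y := e x.
have h1 : e (s x) = X * Y by rewrite es1 mulrC.
have h2 : d (t (s x)) = X ^+ 2 * Y ^+ 3.
  by rewrite dt1 es1 ds -/X -/Y; field; rewrite d0.
have h3 : e (s (t (s x))) = X * Y ^+ 2.
  by rewrite es1 h2 et h1 -/X -/Y; field; rewrite d0 e0.
have h4 : d (t (s (t (s x)))) = X * Y ^+ 3.
  by rewrite dt1 h3 ds h2 -/X -/Y; field; rewrite d0 e0.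
have h5 : e (s (t (s (t (s x))))) = Y.
  by rewrite es1 h4 et h3 -/X -/Y; field; rewrite d0 e0.
have k1 : d (t x) = X * Y ^+ 3 by rewrite dt1.
have k2 : e (s (t x)) = X * Y ^+ 2.
  by rewrite es1 k1 et -/X -/Y; field; rewrite e0.
have k3 : d (t (s (t x))) = X ^+ 2 * Y ^+ 3.
  by rewrite dt1 k2 ds k1 -/X -/Y; field; rewrite d0 e0.
have k4 : e (s (t (s (t x)))) = X * Y.
  by rewrite es1 k3 et k2 -/X -/Y; field; rewrite d0 e0.
have k5 : d (t (s (t (s (t x))))) = X.
  by rewrite dt1 k4 ds k3 -/X -/Y; field; rewrite d0 e0.
rewrite !(Ss, Ut, Sx, Ux) st h1 h2 h3 h4 h5 k1 k2 k3 k4 k5 -/X -/Y.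
have n p q : (0 < p + q)%N -> 1 - X ^+ p * Y ^+ q != 0 by exact: de1.
have [nX nY] : 1 - X != 0 /\ 1 - Y != 0 by split; [exact: d1|exact: e1].
clearbody X Y; field.
(* Besides [X] and [Y], the denominators come from the other four positive roots of $G_2$. *)
by rewrite nX nY (n 1%N 1%N) // (n 1%N 2) // (n 1%N 3) // (n 2 3).
Qed.

End RankTwoBraid.

(** * Alternating words and the rank two root systems *)

Section AlternatingWords.
Variable r : nat.
Implicit Types i j : 'I_r.

(* Unlike [alt_word], indexed by its last letter, which is [j]. *)
Fixpoint altr k i j : seq 'I_r :=
  if k is k'.+1 then rcons (altr k' j i) j else [::].

Lemma size_altr k i j : size (altr k i j) = k.
Proof. by elim: k i j => //= k IHk i j; rewrite size_rcons IHk. Qed.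

Lemma altrS k i j : altr k.+1 i j = (if odd k then i else j) :: altr k i j.
Proof.
elim: k i j => // k IHk i j; rewrite [LHS]/= -/(altr k.+1 j i) IHk rcons_cons.
by rewrite /=; case: odd.
Qed.

Lemma alt_word_altr k i j :
  alt_word k i j = if odd k then altr k j i else altr k i j.
Proof.
elim: k => // k IHk.
rewrite /alt_word -addn1 iotaD map_cat /= add0n cats1 -/(alt_word k i j) IHk.
by rewrite addn1 /=; case: odd.
Qed.

End AlternatingWords.

(* Coefficients, on the simple roots [i] and [j], of the image of the simple
   root [i] under the alternating word of length [k] ending in [j], where
   [b = - a_ij] and [c = - a_ji]. *)
Fixpoint alt_coef (b c : int) (k : nat) : int * int :=
  if k is k'.+1 then
    let: (p, q) := alt_coef b c k' in
    if odd k' then (b * q - p, q) else (p, c * p - q)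
  else (1, 0).

(** Coefficients, on the simple roots [i] and [j], of the displacement of a vector under the
    alternating word of length [k] ending in [j]; here [x] and [y] are its values on the two
    coroots. *)
Fixpoint alt_shift (K : pzRingType) (b c x y : K) (k : nat) : K * K :=
  if k is k'.+1 then
    let: (p, q) := alt_shift b c x y k' in
    if odd k' then (b * q - p - x, q) else (p, c * p - q - y)
  else (0, 0).

(* The order of [s_i s_j], with 0 for infinite order. *)
Definition cox_order (b c : int) : nat :=
  if b * c == 0 then 2 else if b * c == 1 then 3 else
  if b * c == 2 then 4 else if b * c == 3 then 6 else 0.

(** The types $A_1\times A_1$, $A_2$, $B_2$ and $G_2$, the last two in both orientations, and the
    infinite dihedral case. *)
Variant rank_two_spec : int -> int -> nat -> Prop :=
| RankTwo2 : rank_two_spec 0 0 2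
| RankTwo3 : rank_two_spec 1 1 3
| RankTwo4 : rank_two_spec 1 2 4
| RankTwo4' : rank_two_spec 2 1 4
| RankTwo6 : rank_two_spec 1 3 6
| RankTwo6' : rank_two_spec 3 1 6
| RankTwoInf b c of 0 <= b & 0 <= c & 4 <= b * c : rank_two_spec b c 0.

(** If $0<bc<4$, both factors lie in $\{1,2,3\}$, which leaves finitely many cases. *)
Lemma rank_twoP (b c : int) : 0 <= b -> 0 <= c -> (b = 0 <-> c = 0) ->
  rank_two_spec b c (cox_order b c).
Proof.
move=> b0 c0 bc0; have [bc4|bc4] := leP 4 (b * c).
  rewrite /cox_order; do 4![case: eqP => [e|_]; first by rewrite e in bc4].
  by constructor.
have [bz|bn] := eqVneq b 0; first by rewrite bz (bc0.1 bz); constructor.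
have cn : c != 0 by apply: contra_neq bn => /bc0.
have bp : 0 < b by rewrite lt_def bn.
have cp : 0 < c by rewrite lt_def cn.
have : [\/ c = 1, c = 2 | c = 3].
  have : c <= 3 by nia.
  by case: (c) cp => [[|[|[|[|n]]]]|n] //;
    [constructor 1|constructor 2|constructor 3].
have : [\/ b = 1, b = 2 | b = 3].
  have : b <= 3 by nia.
  by case: (b) bp => [[|[|[|[|n]]]]|n] //;
    [constructor 1|constructor 2|constructor 3].
by case=> ->; case=> be; rewrite be in bc4 *; try constructor.
Qed.

(** A finite check when the order is finite. Otherwise the induction also carries $2p\le bq$ or
    $2q\le cp$ for the coefficient about to be reflected: that coefficient does not decrease, and
    $bc\ge 4$ passes the inequality on to the other one. *)
Lemma alt_coef_ge0 (b c : int) k : 0 <= b -> 0 <= c -> (b = 0 <-> c = 0) ->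
    cox_order b c = 0%N \/ (k < cox_order b c)%N ->
  0 <= (alt_coef b c k).1 /\ 0 <= (alt_coef b c k).2.
Proof.
move=> b0 c0 bc0; case: rank_twoP => // [||||||b' c' b'0 c'0 bc4 _];
  try by case=> //; do 6?[case: k => [|k] //].
have : [/\ 0 <= (alt_coef b' c' k).1, 0 <= (alt_coef b' c' k).2 &
  if odd k then 2 * (alt_coef b' c' k).1 <= b' * (alt_coef b' c' k).2
  else 2 * (alt_coef b' c' k).2 <= c' * (alt_coef b' c' k).1]; last by case.
elim: k => [|k] /=; first by split=> //; rewrite mulr0 mulr1.
by case: (alt_coef b' c' k) => p q /=; case: odd => -[p0 q0 h] /=;
  split=> //; nia.
Qed.

Section RankTwoAction.
Variables (r : nat) (A : gcm r) (i j : 'I_r).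
Hypothesis ij : i != j.

Lemma gcm_opp_ge0 :
  [/\ 0 <= - A i j, 0 <= - A j i & (- A i j = 0 <-> - A j i = 0)].
Proof.
have ji : j != i by rewrite eq_sym.
rewrite !oppr_ge0 !gcm_offdiag //; split=> //.
by split=> /eqP; rewrite oppr_eq0 => /eqP/gcm_eq0 ->; rewrite oppr0.
Qed.

(** Each reflection changes one coefficient by the recursion of [alt_coef], and nonnegativity makes
    the integer coefficients natural numbers. *)
Lemma altr_root_coef (V : zmodType) (alpha : 'I_r -> V)
    (s : 'I_r -> V -> V) k :
    (forall k, {morph s k : x y / x - y}) ->
    (forall k l, s k (alpha l) = alpha l - alpha k *~ A k l) ->
    cox_order (- A i j) (- A j i) = 0%N \/
      (k < cox_order (- A i j) (- A j i))%N ->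
  exists p q, foldr s (alpha i) (altr k i j) = alpha i *+ p + alpha j *+ q.
Proof.
move=> sB s_root kP; have [b0 c0 bc0] := gcm_opp_ge0.
have sZ l z x : s l (x *~ z) = s l x *~ z.
  have s0 : s l 0 = 0 by rewrite -{1}(subrr 0) sB subrr.
  have sN y : s l (- y) = - s l y by rewrite -[- y]sub0r sB s0 sub0r.
  have sD y y' : s l (y + y') = s l y + s l y'.
    by rewrite -{1}[y']opprK sB sN opprK.
  have sM y n : s l (y *+ n) = s l y *+ n.
    by elim: n => [|n IHn]; rewrite ?s0 // !mulrS sD IHn.
  by case: z => n; rewrite ?NegzE -?mulNrNz -?pmulrn ?nmulrn ?sN ?sM.
have sD l y y' : s l (y + y') = s l y + s l y'.
  by rewrite -{1}[y']opprK sB -(mulrN1z y') sZ mulrN1z opprK.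
have [p0 q0] := alt_coef_ge0 b0 c0 bc0 kP.
suff -> : foldr s (alpha i) (altr k i j) =
    alpha i *~ (alt_coef (- A i j) (- A j i) k).1 +
    alpha j *~ (alt_coef (- A i j) (- A j i) k).2.
  case: (_.1) (_.2) p0 q0 => [p|//] [q|//] _ _; by exists p, q.
elim: k {kP p0 q0} => [|k IHk]; first by rewrite mulr1z mulr0z addr0.
rewrite altrS /= {}IHk; case: (alt_coef _ _ k) => p q.
case: odd; rewrite sD !sZ !s_root !gcm_diag /= !mulrzBl -!mulrzA.
  rewrite (_ : - A i j * q - p = p - 2 * p - A i j * q); last by ring.
  by rewrite !mulrzBr -!addrA; congr (_ + (_ + _)); rewrite addrC.
rewrite (_ : - A j i * p - q = q - 2 * q - A j i * p); last by ring.
rewrite !mulrzBr -!addrA; congr (_ + _).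
by rewrite addrC -!addrA.
Qed.

(** Both words displace [x] inside the span of the two roots, by expressions in the two coroot
    values of [x] that are compared type by type; for infinite order both words are empty. *)
Lemma altr_cox_act (K : comRingType) (V : lmodType K) (alpha : 'I_r -> V)
    (ev : 'I_r -> V -> K) (s : 'I_r -> V -> V) x :
  let m := cox_order (- A i j) (- A j i) in
    (forall k y z, ev k (y + z) = ev k y + ev k z) ->
    (forall k a y, ev k (a *: y) = a * ev k y) ->
    (forall k l, ev k (alpha l) = (A k l)%:~R) ->
    (forall k y, s k y = y - ev k y *: alpha k) ->
  foldr s x (altr m i j) = foldr s x (altr m j i).
Proof.
move=> m evD evZ ev_root sE.
have sl p q : s i (x + (p *: alpha i + q *: alpha j)) =
   x + (((- A i j)%:~R * q - p - ev i x) *: alpha i + q *: alpha j).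
  rewrite sE !evD !evZ !ev_root gcm_diag -!addrA; congr (_ + _).
  rewrite [RHS]addrC addrCA; congr (_ + _).
  by rewrite -scalerBl; congr (_ *: _); ring.
have sr p q : s j (x + (p *: alpha i + q *: alpha j)) =
   x + (p *: alpha i + ((- A j i)%:~R * p - q - ev j x) *: alpha j).
  rewrite sE !evD !evZ !ev_root gcm_diag -!addrA; congr (_ + (_ + _)).
  by rewrite -scalerBl; congr (_ *: _); ring.
pose sh := alt_shift (- A i j)%:~R (- A j i)%:~R (ev i x) (ev j x).
pose sh' := alt_shift (- A j i)%:~R (- A i j)%:~R (ev j x) (ev i x).
have shE k : foldr s x (altr k i j) =
    x + ((sh k).1 *: alpha i + (sh k).2 *: alpha j).
  elim: k => [|k IHk]; first by rewrite !scale0r !addr0.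
  rewrite altrS /= {}IHk /sh /=; case: (alt_shift _ _ _ _ k) => p q /=.
  by case: odd; rewrite ?sl ?sr.
have sh'E k : foldr s x (altr k j i) =
    x + ((sh' k).2 *: alpha i + (sh' k).1 *: alpha j).
  elim: k => [|k IHk]; first by rewrite !scale0r !addr0.
  rewrite altrS /= {}IHk /sh' /=; case: (alt_shift _ _ _ _ k) => p q /=.
  by case: odd; rewrite ?sl ?sr.
rewrite shE sh'E /sh /sh' {sh sh' shE sh'E} /m.
have [b0 c0 bc0] := gcm_opp_ge0.
by case: rank_twoP => // *; congr (_ + (_ *: _ + _ *: _)); rewrite /=; ring.
Qed.

End RankTwoAction.

(** * The Weyl group *)

Section WeylGroup.
Variables (R : realType) (r : nat) (A : gcm r) (D : realization R A).

Local Notation V := 'Hom(cartan D, R[i]^o).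
Local Notation W := (weyl D).
Local Notation alpha i := (simple_root D i).
Local Notation s_ i := (sgen D i).
Local Notation wd := (word_weyl D).

Lemma weyl_mulE (u w : W) (x : V) : val (u * w)%g x = val u (val w x).
Proof. by rewrite /= comp_lfunE. Qed.

Lemma weyl_1E (x : V) : val (1%g : W) x = x.
Proof. by rewrite /= id_lfunE. Qed.

Lemma sgenE i (x : V) : val (s_ i) x = x - x (coroot D i) *: alpha i.
Proof. by rewrite /= comp_lfun1r lfunE. Qed.

Lemma sgen_root i j :
  val (s_ i) (alpha j) = alpha j - (A i j)%:~R *: alpha i.
Proof. by rewrite sgenE root_coroot. Qed.

Lemma sgen_rootN i : val (s_ i) (alpha i) = - alpha i.
Proof.
rewrite sgen_root gcm_diag (_ : 2%:~R = 1 + 1) // scalerDl scale1r.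
by rewrite opprD addNKr.
Qed.

Lemma sgenK i : (s_ i * s_ i = 1)%g.
Proof. by apply: val_inj; rewrite /= !comp_lfun1r sreflK. Qed.

Lemma mulg_sgenK i (w : W) : (w * s_ i * s_ i)%g = w.
Proof. by rewrite -mulgA sgenK mulg1. Qed.

Lemma word_weyl_rcons s i : wd (rcons s i) = (wd s * s_ i)%g.
Proof. by rewrite /word_weyl -cats1 big_cat /= big_seq1. Qed.

Lemma word_weyl_cons s i : wd (i :: s) = (s_ i * wd s)%g.
Proof. by rewrite /word_weyl big_cons. Qed.

Lemma word_weyl_nil : wd [::] = 1%g.
Proof. by rewrite /word_weyl big_nil. Qed.

Lemma root_lincomb_eq0 (c : 'I_r -> R[i]) :
  \sum_k c k *: alpha k = 0 -> forall k, c k = 0.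
Proof.
move=> c0; have /freeP := root_free D; apply.
by rewrite -[RHS]c0; apply: eq_bigr => k _; rewrite -tnth_nth tnth_mktuple.
Qed.

Lemma simple_root_neq0 i : alpha i != 0.
Proof.
have /free_not0 := root_free D; apply.
by apply/mapP; exists i; rewrite ?mem_enum.
Qed.

Lemma weyl_root_neq0 (w : W) i : val w (alpha i) != 0.
Proof.
apply: contraNneq (simple_root_neq0 i) => w0.
by rewrite -[alpha i]weyl_1E -(mulVg w) weyl_mulE w0 linear0.
Qed.

Lemma root_comb_eq0 (c : 'I_r -> nat) :
  \sum_k alpha k *+ c k = 0 -> forall k, c k = 0%N.
Proof.
move=> c0 k; have /root_lincomb_eq0/(_ k) : \sum_k (c k)%:R *: alpha k = 0.
  by rewrite -[RHS]c0; apply: eq_bigr => k' _; rewrite scaler_nat.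
by move/eqP; rewrite pnatr_eq0 => /eqP.
Qed.

Definition pos_comb (x : V) : Prop :=
  exists c : 'I_r -> nat, x = \sum_k alpha k *+ c k.

Lemma pos_combD x y : pos_comb x -> pos_comb y -> pos_comb (x + y).
Proof.
move=> [c ->] [c' ->]; exists (fun k => c k + c' k)%N; rewrite -big_split /=.
by apply: eq_bigr => k _; rewrite mulrnDr.
Qed.

Lemma pos_comb0 : pos_comb 0.
Proof. by exists (fun=> 0%N); rewrite big1. Qed.

Lemma pos_combMn x n : pos_comb x -> pos_comb (x *+ n).
Proof.
move=> px; elim: n => [|n IHn]; first exact: pos_comb0.
by rewrite mulrS; exact: pos_combD.
Qed.

Lemma pos_comb_root i : pos_comb (alpha i).
Proof.
exists (fun k => nat_of_bool (k == i)); rewrite (bigD1 i) //= eqxx mulr1n.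
by rewrite big1 ?addr0 // => k /negPf ->.
Qed.

(** The natural coefficients of [x] and [- x] add up to zero by independence of the simple roots, so
    all of them vanish. *)
Lemma pos_comb_anti x : pos_comb x -> pos_comb (- x) -> x = 0.
Proof.
move=> [c xE] [c' xE'].
have c0 : forall k, (c k + c' k = 0)%N.
  apply: root_comb_eq0; rewrite -[RHS](subrr x) [in RHS]xE' {1}xE -big_split /=.
  by apply: eq_bigr => k _; rewrite mulrnDr.
rewrite xE big1 // => k _; have /eqP := c0 k.
by rewrite addn_eq0 => /andP[/eqP -> _].
Qed.

(** Translates equality of the two alternating words of length [k] into $(s_is_j)^k=1$. *)
Lemma word_altr_exp k i j :
  wd (altr k i j) = (wd (altr k j i) * (s_ i * s_ j) ^+ k)%g.
Proof.
(* Conjugation by $s_j$ inverts $s_is_j$. *)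
have flip n : ((s_ i * s_ j) ^+ n * s_ j * (s_ i * s_ j) ^+ n = s_ j)%g.
  elim: n => [|n IHn]; first by rewrite expg0 mul1g mulg1.
  rewrite {1}expgSr expgS !mulgA !mulg_sgenK; exact: IHn.
elim: k => [|k IHk]; first by rewrite mulg1.
rewrite /= !word_weyl_rcons expgS !mulgA mulg_sgenK IHk -!mulgA.
by congr (_ * _)%g; rewrite !mulgA flip.
Qed.

End WeylGroup.

(** * Matsumoto's theorem *)

Lemma altr_split r (i j : 'I_r) m k : (m <= k)%N ->
  exists2 s, size s = (k - m)%N & altr k i j = s ++ altr m i j.
Proof.
elim: k => [|k IHk]; first by rewrite leqn0 => /eqP ->; exists [::].
rewrite leq_eqVlt => /predU1P[->|]; first by exists [::]; rewrite ?subnn.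
rewrite ltnS => mk; have [s ss sE] := IHk mk.
exists ((if odd k then i else j) :: s); first by rewrite /= ss subSn.
by rewrite altrS sE.
Qed.

Section Matsumoto.
Variables (r : nat) (W : groupType) (s_ : 'I_r -> W) (len : W -> nat).
Variables (cox : 'I_r -> 'I_r -> nat) (pos : W -> 'I_r -> Prop).
(** Stands for the congruence defining the monoid; the combinatorics uses it only through the braid
    and idempotent relations assumed below. *)
Variable cong : seq 'I_r -> seq 'I_r -> Prop.
Implicit Types (i j : 'I_r) (u v w : W) (s t : seq 'I_r).

Local Notation wd t := (\prod_(k <- t) s_ k)%g.

Hypothesis sK : forall i, (s_ i * s_ i = 1)%g.
Hypothesis len_word : forall t, (len (wd t) <= size t)%N.
Hypothesis reduced_word_ex : forall w, exists2 t, wd t = w & size t = len w.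
(* [pos w i] stands for: [w] maps the simple root [i] to a positive root. *)
Hypothesis pos1 : forall i, pos 1%g i.
Hypothesis pos_sgen : forall w i, pos w i -> ~ pos (w * s_ i)%g i.
Hypothesis pos_altr : forall w i j k, i != j -> pos w i -> pos w j ->
  cox i j = 0%N \/ (k < cox i j)%N -> pos (w * wd (altr k i j))%g i.
Hypothesis coxC : forall i j, cox i j = cox j i.
Hypothesis altr_cox :
  forall i j, i != j -> wd (altr (cox i j) i j) = wd (altr (cox i j) j i).
Hypothesis cong_refl : forall s, cong s s.
Hypothesis cong_sym : forall s t, cong s t -> cong t s.
Hypothesis cong_trans : forall s t t', cong s t -> cong t t' -> cong s t'.
Hypothesis cong_cat : forall s s' t t',
  cong s s' -> cong t t' -> cong (s ++ t) (s' ++ t').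
Hypothesis cong_idem : forall i, cong [:: i; i] [:: i].
Hypothesis cong_altr : forall i j, i != j -> (0 < cox i j)%N ->
  cong (altr (cox i j) i j) (altr (cox i j) j i).

Let word_cat s t : wd (s ++ t) = (wd s * wd t)%g.
Proof. by rewrite big_cat. Qed.

Let word_rcons s i : wd (rcons s i) = (wd s * s_ i)%g.
Proof. by rewrite -cats1 big_cat /= big_seq1. Qed.

Let mulg_sK i w : (w * s_ i * s_ i)%g = w.
Proof. by rewrite -mulgA sK mulg1. Qed.

Lemma len_mul u v : (len (u * v)%g <= len u + len v)%N.
Proof.
have [s <- <-] := reduced_word_ex u; have [t <- <-] := reduced_word_ex v.
by rewrite -word_cat -size_cat len_word.
Qed.

Lemma len_mul_word u s : (len (u * wd s)%g <= len u + size s)%N.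
Proof. by apply: leq_trans (len_mul _ _) _; rewrite leq_add2l len_word. Qed.

Lemma len_mul_sgen w i : (len (w * s_ i)%g <= (len w).+1)%N.
Proof. by have := len_mul_word w [:: i]; rewrite big_seq1 addn1. Qed.

Lemma len_mul_sgenV w i : (len w <= (len (w * s_ i)%g).+1)%N.
Proof. by rewrite -{1}(mulg_sK i w) len_mul_sgen. Qed.

(** Descents among [i] and [j] are stripped from the right until none is left. The stripped letters
    alternate, since two equal neighbours would cancel and contradict the length. *)
Lemma dihedral_decomposition w i j : exists w' k,
  [/\ len w = (len w' + k)%N, (len w' <= len (w' * s_ i)%g)%N,
      (len w' <= len (w' * s_ j)%g)%N &
      w = (w' * wd (altr k i j))%g \/ w = (w' * wd (altr k j i))%g].
Proof.
have [n] := ubnP (len w); elim: n => // n IHn in w i j *.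
rewrite ltnS => le_n.
wlog wi : i j / (len (w * s_ i)%g < len w)%N.
  move=> th; have [wi|wi] := ltnP (len (w * s_ i)%g) (len w); first exact: th.
  have [wj|wj] := ltnP (len (w * s_ j)%g) (len w).
    by have [w' [k [? ? ? [?|?]]]] := th j i wj; exists w', k; split; auto.
  by exists w, 0%N; split; rewrite ?addn0 //; left; rewrite big_nil mulg1.
have [w' [k [lenE w'i w'j wE]]] := IHn _ i j (leq_trans wi le_n).
have lenw : len w = (len w' + k.+1)%N.
  apply/eqP; rewrite eqn_leq addnS -lenE wi andbT; exact: len_mul_sgenV.
case: wE => wE.
  exists w', k.+1; split=> //; right.
  by rewrite /= word_rcons mulgA -wE mulg_sK.
case: k wE lenE lenw => [|k] wE lenE lenw.
  exists w', 1%N; split=> //; right.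
  by rewrite big_seq1 -[LHS](mulg_sK i) wE big_nil !mulg1.
have : (len w <= len w' + k)%N.
  rewrite -[w](mulg_sK i) wE [altr _ _ _]/= word_rcons mulgA mulg_sK.
  by rewrite -{2}(size_altr k i j); exact: len_mul_word.
by rewrite lenw leq_add2l ltnNge leqnSn.
Qed.

(** Induction on length. The last letter [j] of a reduced word is a descent, hence differs from [i],
    and in $w=w'u$ with $u$ dihedral the factor $w'$ is shorter. As [i] is not a descent, $u$ has no
    expression of length at most [k] ending in [i], which forces [k] below the order by the braid
    relation; then [pos_altr] applies. *)
Lemma pos_len w i : (len w <= len (w * s_ i)%g)%N -> pos w i.
Proof.
have [n] := ubnP (len w); elim: n => // n IHn in w i *.
rewrite ltnS => le_n wi.
have [t tE ts] := reduced_word_ex w.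
case/lastP: t => [|t j] in tE ts *; first by rewrite -tE big_nil.
have wj : (len (w * s_ j)%g < len w)%N.
  by rewrite -ts size_rcons ltnS -tE word_rcons mulg_sK len_word.
have ij : i != j by apply: contraTneq wi => ->; rewrite -ltnNge.
have [w' [k [lenE w'i w'j w'E]]] := dihedral_decomposition w i j.
have k0 : (0 < k)%N.
  rewrite lt0n; apply: contraTneq wj => k0; rewrite -leqNgt.
  by case: w'E => ->; rewrite k0 big_nil mulg1.
have w'w : (len w' < n)%N.
  by apply: leq_trans le_n; rewrite lenE -addn1 leq_add2l.
have lt_abs s : w = (w' * wd (rcons s i))%g -> (size s < k)%N -> False.
  move=> wE' sk; have : (len (w * s_ i)%g <= len w' + size s)%N.
    by rewrite wE' word_rcons mulgA mulg_sK len_mul_word.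
  move/(leq_trans wi); rewrite lenE leq_add2l leqNgt sk; by [].
case: w'E => w'E; last first.
  case: k {lenE k0} lt_abs w'E => [|k] // lt_abs w'E.
    by rewrite w'E big_nil mulg1; exact: IHn.
  by case: (lt_abs _ w'E); rewrite size_altr.
have [c0|c0] := posnP (cox i j).
  by rewrite w'E; apply: pos_altr; [|exact: IHn|exact: IHn|left].
have [kc|ck] := ltnP k (cox i j).
  by rewrite w'E; apply: pos_altr; [|exact: IHn|exact: IHn|right].
have [s ss sE] := altr_split i j ck.
move: w'E; rewrite sE word_cat altr_cox // -word_cat.
case: (cox i j) c0 ck ss => [|c] // _ ck ss; rewrite /= -rcons_cat => w'E.
case: (lt_abs _ w'E); rewrite size_cat ss size_altr.
by rewrite -ltnS -addnS subnK.
Qed.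

(** Equal lengths would make both $w$ and $ws_i$ positive on the root [i]. *)
Lemma len_mul_sgen_lt w i :
  (len (w * s_ i)%g <= len w)%N -> (len (w * s_ i)%g < len w)%N.
Proof.
move=> wi; rewrite ltnNge; apply/negP => /pos_len/pos_sgen; apply.
by apply: pos_len; rewrite mulg_sK.
Qed.

(** If the dihedral part were shorter than the order, [w] would be positive on [i], which a descent
    excludes. So the full alternating word splits off on the right, with additive length. *)
Lemma two_descents w i j : i != j ->
    (len (w * s_ i)%g < len w)%N -> (len (w * s_ j)%g < len w)%N ->
  exists2 x, len w = (len x + cox i j)%N &
    (0 < cox i j)%N /\ w = (x * wd (altr (cox i j) i j))%g.
Proof.
move=> ij wi wj.
have [w' [k [lenE w'i w'j w'E]]] := dihedral_decomposition w i j.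
wlog w'E1 : i j ij wi wj w'i w'j {w'E} / w = (w' * wd (altr k i j))%g.
  move=> th; case: w'E => w'E; first exact: th.
  have ji : j != i by rewrite eq_sym.
  have [x lx [c0 xE]] := th _ _ ji wj wi w'j w'i w'E.
  by exists x; rewrite (coxC i j) // -(altr_cox ji).
have ng : ~ (cox i j = 0%N \/ (k < cox i j)%N).
  move/(pos_altr ij (pos_len w'i) (pos_len w'j)); rewrite -w'E1.
  by move/pos_sgen; apply; apply: pos_len; rewrite mulg_sK ltnW.
have c0 : (0 < cox i j)%N by rewrite lt0n; apply/eqP => c0; apply: ng; left.
have ck : (cox i j <= k)%N.
  by rewrite leqNgt; apply/negP => kc; apply: ng; right.
have [s ss sE] := altr_split i j ck.
have wE : w = (w' * wd s * wd (altr (cox i j) i j))%g.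
  by rewrite -mulgA -word_cat -sE.
exists (w' * wd s)%g => //; apply/eqP; rewrite eqn_leq.
apply/andP; split.
  have := len_mul_word (w' * wd s)%g (altr (cox i j) i j).
  by rewrite -wE size_altr.
rewrite lenE -[k in X in (_ <= X)%N](subnK ck) addnA leq_add2r -ss.
exact: len_mul_word.
Qed.

Let cong_rcons s t i : cong s t -> cong (rcons s i) (rcons t i).
Proof. by move=> st; rewrite -!cats1; exact: cong_cat. Qed.

(** Induction on length, immediate for equal last letters. Distinct last letters are two descents,
    so each word is linked, through words sharing its last letter, to a common prefix followed by
    one side of the braid relation. *)
Lemma matsumoto s t : size s = len (wd s) -> size t = len (wd t) ->
  wd s = wd t -> cong s t.
Proof.
move sn: (size s) => n; elim: n => [|n IHn] in s t sn *.
  move=> ls lt st; rewrite (size0nil sn) (size0nil (_ : size t = 0%N)).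
    exact: cong_refl.
  by rewrite lt -st -ls.
case/lastP: s => [|s i] // in sn *; rewrite size_rcons in sn; case: sn => sn.
case/lastP: t => [|t j] // ls lt st.
  by move: lt; rewrite -st -ls.
have same k s1 s2 : size s1 = n -> size s2 = n ->
    wd (rcons s1 k) = wd (rcons s2 k) -> len (wd (rcons s1 k)) = n.+1 ->
    cong (rcons s1 k) (rcons s2 k).
  move=> n1 n2 eq12 ln; apply: cong_rcons.
  move: (eq12); rewrite !word_rcons => /mulIg eq12'.
  have l1 : size s1 = len (wd s1).
    apply/eqP; rewrite eqn_leq len_word n1 andbT -ltnS -ln word_rcons.
    by rewrite len_mul_sgen.
  by apply: IHn => //; rewrite -?eq12' -l1 ?n1 ?n2.
have tn : size t = n by apply: succn_inj; rewrite -(size_rcons t j) lt -st -ls.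
have [ij|ij] := eqVneq i j; first by rewrite -ij in st *; apply: same.
have wi : (len (wd (rcons s i) * s_ i)%g < len (wd (rcons s i)))%N.
  by rewrite -ls word_rcons mulg_sK ltnS -sn len_word.
have wj : (len (wd (rcons s i) * s_ j)%g < len (wd (rcons s i)))%N.
  by rewrite -ls st word_rcons mulg_sK ltnS -tn len_word.
have [x lx [c0 xE]] := two_descents ij wi wj.
have [t0 t0E t0s] := reduced_word_ex x.
have cE := altr_cox ij; have := cong_altr ij c0.
case: (cox i j) c0 lx xE cE => [|c] // _ lx xE cE /= braid.
(* Here [k] is a pair of letters, to serve both orders of [i] and [j]. *)
have sx k : size (t0 ++ altr c k.1 k.2) = n.
  by rewrite size_cat t0s size_altr; apply: succn_inj; rewrite -addnS -lx.
apply: (@cong_trans _ (rcons (t0 ++ altr c i j) i)).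
  apply: same => //; first exact: (sx (i, j)).
  by rewrite xE cE rcons_cat word_cat t0E.
apply: (@cong_trans _ (rcons (t0 ++ altr c j i) j)).
  rewrite !rcons_cat; apply: cong_cat; first exact: cong_refl.
  exact: cong_sym.
apply: same => //; first exact: (sx (j, i)).
  by rewrite -st xE rcons_cat word_cat t0E.
by rewrite rcons_cat word_cat t0E -xE.
Qed.

(** Letters are added on the right. A letter that does not increase the length can be made the last
    letter of the reduced word by Matsumoto, and is then absorbed by idempotency. *)
Lemma cong_reduced s :
  exists2 t, cong s t & size t = len (wd t) /\ (size t <= size s)%N.
Proof.
elim/last_ind: s => [|s i [t st [rt ts]]].
  exists [::] => //; split=> //.
  by apply/eqP; rewrite eq_sym -leqn0; exact: len_word.
have [ti|ti] := ltnP (len (wd t)) (len (wd t * s_ i)%g).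
  exists (rcons t i); first exact: cong_rcons.
  rewrite !size_rcons ltnS word_rcons rt; split; last by rewrite -rt.
  by apply/eqP; rewrite eqn_leq ti len_mul_sgen.
exists t; last by rewrite size_rcons (leqW ts).
have [t' t'E rt'] := reduced_word_ex (wd t * s_ i)%g.
have tt' : cong t (rcons t' i).
  apply: matsumoto => //; rewrite word_rcons t'E mulg_sK //.
  rewrite size_rcons rt'; apply/eqP.
  by rewrite eqn_leq len_mul_sgenV len_mul_sgen_lt.
apply: cong_trans (cong_rcons i st) _; apply: cong_trans (cong_rcons i tt') _.
apply: cong_trans (cong_sym tt'); rewrite -!cats1 -catA.
by apply: cong_cat (cong_idem i).
Qed.

End Matsumoto.

(** * The Weyl group as a Coxeter group, and reduced words in the monoid *)

Section WeylCoxeter.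
Variables (R : realType) (r : nat) (A : gcm r) (D : realization R A).

Local Notation V := 'Hom(cartan D, R[i]^o).
Local Notation W := (weyl D).
Local Notation alpha i := (simple_root D i).
Local Notation s_ i := (sgen D i).
Local Notation wd := (word_weyl D).
Local Notation cox i j := (cox_order (- A i j) (- A j i)).
Implicit Types (i j : 'I_r) (u v w : W).

Lemma weylN w (x : V) : val w (- x) = - val w x.
Proof. exact: linearN. Qed.

Lemma weylD w (x y : V) : val w (x + y) = val w x + val w y.
Proof. exact: linearD. Qed.

Lemma weylMn w (x : V) n : val w (x *+ n) = val w x *+ n.
Proof. exact: linearMn. Qed.

Lemma word_weyl_foldr s (x : V) :
  val (wd s) x = foldr (fun k y => val (s_ k) y) x s.
Proof.
elim: s => [|k s IHs]; first by rewrite word_weyl_nil weyl_1E.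
by rewrite word_weyl_cons weyl_mulE IHs.
Qed.

Lemma altr_root i j k : i != j -> cox i j = 0%N \/ (k < cox i j)%N ->
  exists p q, val (wd (altr k i j)) (alpha i) = alpha i *+ p + alpha j *+ q.
Proof.
move=> ij kP; rewrite word_weyl_foldr.
apply: (altr_root_coef ij (s := fun k y => val (s_ k) y)) kP => [l x y|l l'].
  exact: linearB.
by rewrite sgen_root scaler_int.
Qed.

Lemma altr_cox i j : i != j ->
  wd (altr (cox i j) i j) = wd (altr (cox i j) j i).
Proof.
move=> ij; apply: val_inj; apply/lfunP => x; rewrite !word_weyl_foldr.
apply: (altr_cox_act ij (alpha := fun i => alpha i)
  (ev := fun k y => y (coroot D k))) => [k y z|k a y|k l|k y].
- by rewrite add_lfunE.
- by rewrite scale_lfunE.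
- exact: root_coroot.
- exact: sgenE.
Qed.

(** The word ending in [j] sends the root [i] to a positive combination, the one ending in [i] sends
    it to a negative one. *)
Lemma altr_neq i j k : i != j -> (0 < k)%N ->
  cox i j = 0%N \/ (k < cox i j)%N -> wd (altr k i j) <> wd (altr k j i).
Proof.
case: k => // k ij _ kP.
have kP' : cox i j = 0%N \/ (k < cox i j)%N.
  by case: kP => [|/ltnW]; [left|right].
have [p [q pq]] := altr_root ij kP; have [p' [q' pq']] := altr_root ij kP'.
move=> eqw; have := pq; rewrite eqw [altr _ j i]/= word_weyl_rcons weyl_mulE.
rewrite sgen_rootN weylN pq' => eqv.
have : val (wd (altr k i j)) (alpha i) = 0.
  have pos n n' : pos_comb (alpha i *+ n + alpha j *+ n').
    by apply: pos_combD; apply: pos_combMn; exact: pos_comb_root.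
  by rewrite pq'; apply: pos_comb_anti => //; rewrite eqv.
by apply/eqP; exact: weyl_root_neq0.
Qed.

Lemma has_order_cox i j m : i != j ->
  has_order (s_ i * s_ j)%g m -> m = cox i j /\ (0 < cox i j)%N.
Proof.
move=> ij [m0 m1 mmin].
have eqm : wd (altr m i j) = wd (altr m j i) by rewrite word_altr_exp m1 mulg1.
have [c0 cm] : (0 < cox i j)%N /\ (cox i j <= m)%N.
  have [c0|c0] := posnP (cox i j); first by case: (altr_neq ij m0 _ eqm); left.
  split=> //; rewrite leqNgt; apply/negP => mc.
  by case: (altr_neq ij m0 _ eqm); right.
split=> //; apply/eqP; rewrite eqn_leq cm andbT leqNgt; apply/negP => cm'.
apply: (mmin (cox i j)); first by rewrite c0.
by apply: (@mulgI _ (wd (altr (cox i j) j i)));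
    rewrite -word_altr_exp altr_cox // mulg1.
Qed.

Lemma cox_has_order i j : i != j -> (0 < cox i j)%N ->
  has_order (s_ i * s_ j)%g (cox i j).
Proof.
move=> ij c0; split=> // [|k /andP[k0 kc] k1].
  by apply: (@mulgI _ (wd (altr (cox i j) j i)));
    rewrite -word_altr_exp altr_cox // mulg1.
by apply: (altr_neq ij k0); [right|rewrite word_altr_exp k1 mulg1].
Qed.

Lemma size_redword w : size (redword w) = len w.
Proof. exact: size_tuple. Qed.

Lemma word_redword w : wd (redword w) = w.
Proof. by apply/eqP; rewrite /redword; exact: (xchooseP (redword_ex w)). Qed.

Lemma len_word s : (len (wd s) <= size s)%N.
Proof.
rewrite /len; case: ex_minnP => n _; apply; apply/existsP.
by exists (in_tuple s).
Qed.

Lemma reduced_word_ex w : exists2 s, wd s = w & size s = len w.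
Proof. by exists (redword w); [exact: word_redword|exact: size_redword]. Qed.

Lemma pos_comb_sgen w i : pos_comb (val w (alpha i)) ->
  ~ pos_comb (val (w * s_ i)%g (alpha i)).
Proof.
move=> wp; rewrite weyl_mulE sgen_rootN weylN => /(pos_comb_anti wp)/eqP.
by apply/negP; exact: weyl_root_neq0.
Qed.

Lemma pos_comb_altr w i j k : i != j ->
    pos_comb (val w (alpha i)) -> pos_comb (val w (alpha j)) ->
    cox i j = 0%N \/ (k < cox i j)%N ->
  pos_comb (val (w * wd (altr k i j))%g (alpha i)).
Proof.
move=> ij pi pj kP; have [p [q e]] := altr_root ij kP.
by rewrite weyl_mulE e weylD !weylMn; apply: pos_combD; apply: pos_combMn.
Qed.

Lemma dem_cong_altr i j : i != j -> (0 < cox i j)%N ->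
  dem_cong D (altr (cox i j) i j) (altr (cox i j) j i).
Proof.
move=> ij c0; have := dem_braid ij (cox_has_order ij c0).
rewrite !alt_word_altr; case: odd => //; exact: dem_sym.
Qed.

Let pos1 i : pos_comb (val (1%g : W) (alpha i)).
Proof. by rewrite weyl_1E; exact: pos_comb_root. Qed.

Let coxC i j : cox i j = cox j i.
Proof. by rewrite /cox_order mulrC. Qed.

(** The length bound is what later lets the sum start at $m=l(w)$. *)
Lemma dem_cong_redword s :
  exists2 u : W, dem_cong D s (redword u) & (len u <= size s)%N.
Proof.
have [t st [rt ts]] : exists2 t, dem_cong D s t &
    size t = len (wd t) /\ (size t <= size s)%N.
  apply: (@cong_reduced _ _ _ _ _
  (fun w i => pos_comb (val w (alpha i))) (dem_cong D) (@sgenK _ _ _ D)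
  len_word reduced_word_ex pos1 pos_comb_sgen pos_comb_altr coxC altr_cox
  (@dem_refl _ _ _ D) (@dem_sym _ _ _ D) (@dem_trans _ _ _ D)
  (@dem_cat _ _ _ D) (@dem_idem _ _ _ D) dem_cong_altr s).
exists (wd t); last by rewrite -rt.
apply: dem_trans st _.
have mats := @matsumoto _ _ _ _ _
  (fun w i => pos_comb (val w (alpha i))) (dem_cong D) (@sgenK _ _ _ D)
  len_word reduced_word_ex pos1 pos_comb_sgen pos_comb_altr coxC altr_cox
  (@dem_refl _ _ _ D) (@dem_sym _ _ _ D) (@dem_trans _ _ _ D)
  (@dem_cat _ _ _ D) dem_cong_altr.
apply: mats; first exact: rt.
  by rewrite size_redword -/(wd _) word_redword.
by rewrite -!/(wd _) word_redword.
Qed.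

End WeylCoxeter.

(** * Demazure operators *)

Section DemazureOperators.
Variables (R : realType) (r : nat) (A : gcm r) (D : realization R A).

Local Notation W := (weyl D).
Local Notation s_ i := (sgen D i).
Local Notation wd := (word_weyl D).
Local Notation cox i j := (cox_order (- A i j) (- A j i)).
Local Notation act := (@weyl_act R r A D).
Local Notation root := (root_wt D).
Implicit Types (i j : 'I_r) (u v w : W) (x y : weight D).

Lemma expwtN x : expwt (- x) = (expwt x)^-1.
Proof.
have e : expwt x * expwt (- x) = 1 by rewrite -expwtD subrr expwt0.
by apply: (mulfI (x := expwt x)); rewrite ?e ?divff //;
  apply: contra_eq_neq e => ->; rewrite mul0r eq_sym oner_neq0.
Qed.

Lemma expwt_neq0 x : expwt x != 0.
Proof.
have : expwt x * expwt (- x) = 1 by rewrite -expwtD subrr expwt0.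
by apply: contra_eq_neq => ->; rewrite mul0r eq_sym oner_neq0.
Qed.

Lemma expwtMn x n : expwt (x *+ n) = expwt x ^+ n.
Proof. by elim: n => [|n IHn]; rewrite ?expwt0 // mulrS expwtD IHn exprS. Qed.

Lemma weyl_actM u v x : act (u * v)%g x = act u (act v x).
Proof. by apply: val_inj; exact: weyl_mulE. Qed.

Lemma weyl_act1 x : act 1%g x = x.
Proof. by apply: val_inj; exact: weyl_1E. Qed.

Lemma weyl_actD u x y : act u (x + y) = act u x + act u y.
Proof. by apply: val_inj; rewrite raddfD; exact: weylD. Qed.

Lemma weyl_act0 u : act u 0 = 0.
Proof. by apply: (addrI (act u 0)); rewrite -weyl_actD !addr0. Qed.

Lemma weyl_actN u x : act u (- x) = - act u x.
Proof. by apply: val_inj; rewrite raddfN; exact: weylN. Qed.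

Lemma weyl_actMn u x n : act u (x *+ n) = act u x *+ n.
Proof.
by elim: n => [|n IHn]; rewrite ?weyl_act0 // !mulrS weyl_actD IHn.
Qed.

Lemma weyl_act_sgen i : act (s_ i) (root i) = - root i.
Proof. by apply: val_inj; rewrite raddfN; exact: sgen_rootN. Qed.

Lemma weyl_act_sgen_neq i j : i != j ->
  act (s_ i) (root j) = root j + root i *+ `|A i j|%N.
Proof.
move=> ij; apply: val_inj; rewrite raddfD raddfMn.
apply: etrans (sgen_root D i j) _.
have := gcm_offdiag A ij; case: (A i j) => [[|n]|n] // _.
  by rewrite scale0r subr0 mulr0n addr0.
by rewrite NegzE scaler_int mulrNz opprK.
Qed.

(** The weight $\rho$ takes the value 1 on each simple coroot. *)
Lemma weyl_act_sgen_rho i : act (s_ i) (rho D) = rho D - root i.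
Proof.
apply: val_inj; rewrite raddfB; apply: etrans (sgenE _ _) _.
have -> : val (rho D) (coroot D i) = 1.
  rewrite /rho raddf_sum sum_lfunE (bigD1 i) //= fundwt_coroot eqxx.
  rewrite big1 ?addr0 //.
  by move=> k /negPf ki; rewrite fundwt_coroot ki.
by rewrite scale1r.
Qed.

End DemazureOperators.

(** * The Demazure operators as an action of the monoid *)

Section DemazureBraid.
Variables (R : realType) (r : nat) (A : gcm r) (D : realization R A).

Local Notation W := (weyl D).
Local Notation s_ i := (sgen D i).
Local Notation wd := (word_weyl D).
Local Notation cox i j := (cox_order (- A i j) (- A j i)).
Local Notation act := (@weyl_act R r A D).
Local Notation root := (root_wt D).
Implicit Types (i j : 'I_r) (u v w : W) (x y : weight D) (f : W -> QT D).

Let d i v := expwt (- act v (root i)).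

Let avg i := dem_avg (fun v => (v * s_ i)%g) (d i).

Let opD_avg : @opD R r A D = avg.
Proof. by []. Qed.

Let mul_sgenK i : involutive (fun v : W => (v * s_ i)%g).
Proof. exact: mulg_sgenK. Qed.

Let d_neq0 i v : d i v != 0. Proof. exact: expwt_neq0. Qed.

Let d_sgen i v : d i (v * s_ i)%g = (d i v)^-1.
Proof. by rewrite /d weyl_actM weyl_act_sgen weyl_actN -expwtN. Qed.

Let d_sgen_neq i j v : i != j ->
  d j (v * s_ i)%g = d j v * d i v ^+ `|A i j|.
Proof.
move=> ij; rewrite /d weyl_actM weyl_act_sgen_neq // weyl_actD weyl_actMn.
by rewrite opprD expwtD -mulNrn expwtMn.
Qed.

Let expwt_neq1 x : x <> 0 -> 1 - expwt x != 0.
Proof.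
move=> x0; apply/eqP => /subr0_eq e; apply: x0.
by apply/esym/expwt_inj; rewrite expwt0.
Qed.

Let weyl_act_eq0 v x : act v x = 0 -> x = 0.
Proof.
by move=> e; rewrite -[LHS]weyl_act1 -(mulVg v) weyl_actM e weyl_act0.
Qed.

Let root_neq0 i : root i <> 0.
Proof.
move=> /(congr1 val) e; have /eqP := simple_root_neq0 D i; apply.
by apply: etrans e _; rewrite raddf0.
Qed.

Let d_neq1 i v : 1 - d i v != 0.
Proof.
apply: expwt_neq1 => e; apply: (@root_neq0 i); apply: (weyl_act_eq0 (v := v)).
by rewrite -[LHS]opprK e oppr0.
Qed.

(** The monomial is the exponential of $-v(p\alpha_i+q\alpha_j)$, a nonzero weight by independence
    of the simple roots. *)
Let dd_neq1 i j v p q : i != j -> (0 < p + q)%N ->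
  1 - d i v ^+ p * d j v ^+ q != 0.
Proof.
move=> ij pq0.
have -> : d i v ^+ p * d j v ^+ q = expwt (- act v (root i *+ p + root j *+ q)).
  by rewrite weyl_actD !weyl_actMn opprD expwtD -!mulNrn !expwtMn.
apply: expwt_neq1 => /eqP; rewrite oppr_eq0 => /eqP/weyl_act_eq0/(congr1 val).
rewrite raddfD !raddfMn raddf0 => e.
have single l n :
    \sum_k simple_root D k *+ ((k == l) * n) = simple_root D l *+ n.
  by rewrite (bigD1 l) //= eqxx mul1n big1 ?addr0 // => k /negPf ->.
have /root_comb_eq0 e0 :
    \sum_k simple_root D k *+ ((k == i) * p + (k == j) * q) = 0.
  apply: etrans e; rewrite -!single -big_split /=.
  by apply: eq_bigr => k _; rewrite mulrnDr.
have := e0 i; have := e0 j; rewrite !eqxx (negPf ij) [j == i]eq_sym (negPf ij).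
by rewrite !mul1n !mul0n addn0 add0n => q0 p0; rewrite q0 p0 in pq0.
Qed.

Lemma opD_idem i f : opD i (opD i f) = opD i f.
Proof.
rewrite opD_avg; apply/funext => v.
have := dem_avg_idem (mul_sgenK i) (d_neq0 i) (d_neq1 i) (d_sgen i).
exact.
Qed.

Lemma opD_altr i j f : i != j -> (0 < cox i j)%N ->
  foldr (@opD _ _ _ D) f (altr (cox i j) i j) =
  foldr (@opD _ _ _ D) f (altr (cox i j) j i).
Proof.
move=> ij; have ji : j != i by rewrite eq_sym.
have := fun v => d_sgen_neq v ij; have := fun v => d_sgen_neq v ji.
have := altr_cox D ij; rewrite -[`|A i j|%N]abszN -[`|A j i|%N]abszN.
have [b0 c0 bc0] := gcm_opp_ge0 A ij.
have di1 v p q : (0 < p + q)%N -> 1 - d i v ^+ p * d j v ^+ q != 0.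
  exact: dd_neq1.
have dj1 v p q : (0 < p + q)%N -> 1 - d j v ^+ p * d i v ^+ q != 0.
  exact: dd_neq1.
(* Nested averages evaluate at successive right translates, that is, at a left fold; [walkE] carries
   the braid relation of $W$ over to these points. *)
pose walk := foldl (fun u k => (u * s_ k)%g).
have walkE s u : walk u s = (u * wd s)%g.
  rewrite /walk; elim: s u => [|k s IHs] u.
    by rewrite word_weyl_nil mulg1.
  by rewrite word_weyl_cons mulgA -IHs.
have word_mul s t : wd s = wd t -> forall u, walk u s = walk u t.
  by move=> st u; rewrite !walkE st.
rewrite opD_avg; case: (rank_twoP b0 c0 bc0); last by [].
all: move=> hw hji hij _; apply/funext => u.
all: have hw' := word_mul _ _ (esym hw); have {}hw := word_mul _ _ hw.
- exact: (dem_avg_braid2 hij hji di1 erefl erefl hw' f u).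
- exact: esym (dem_avg_braid3 (mul_sgenK i) (mul_sgenK j) (d_neq0 i)
    (d_neq0 j) (d_sgen i) (d_sgen j) hij hji di1 erefl erefl hw' f u).
- exact: (dem_avg_braid4 (mul_sgenK i) (mul_sgenK j) (d_neq0 i)
    (d_neq0 j) (d_sgen i) (d_sgen j) hij hji di1 erefl erefl hw' f u).
(* The rank two identity is stated for entries 1 and 2, so the transposed type exchanges [i] and
   [j]. *)
- exact: esym (dem_avg_braid4 (mul_sgenK j) (mul_sgenK i) (d_neq0 j)
    (d_neq0 i) (d_sgen j) (d_sgen i) hji hij dj1 erefl erefl hw f u).
- exact: (dem_avg_braid6 (mul_sgenK i) (mul_sgenK j) (d_neq0 i)
    (d_neq0 j) (d_sgen i) (d_sgen j) hij hji di1 erefl erefl hw' f u).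
- exact: esym (dem_avg_braid6 (mul_sgenK j) (mul_sgenK i) (d_neq0 j)
    (d_neq0 i) (d_sgen j) (d_sgen i) hji hij dj1 erefl erefl hw f u).
Qed.

Lemma dem_cong_opD s t : dem_cong D s t ->
  forall f, foldr (@opD _ _ _ D) f s = foldr (@opD _ _ _ D) f t.
Proof.
elim=> {s t}
  [i|i j m ij sij|s|s t _ IH|s t u _ IH1 _ IH2|s s' t t' _ IH1 _ IH2] f.
- exact: opD_idem.
- have [-> c0] := has_order_cox ij sij; have e := opD_altr f ij c0.
  by rewrite !alt_word_altr; case: odd.
- by [].
- by rewrite IH.
- by rewrite IH1 IH2.
- by rewrite !foldr_cat IH2 IH1.
Qed.

Lemma opD_shift i f u :
  f (u * s_ i)%g = expwt (act u (root i)) *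
    (f u + (expwt (- act u (root i)) - 1) * opD i f u).
Proof.
have -> : expwt (act u (root i)) = (d i u)^-1 by rewrite /d expwtN invrK.
rewrite opD_avg.
exact: (@dem_avg_shift _ _ (fun v => (v * s_ i)%g) _ f _
          (d_neq0 i u) (d_neq1 i u)).
Qed.

End DemazureBraid.

(** * The localization formula *)

(** One entry for each choice of positions, so equal letters at different positions count
    separately. *)
Fixpoint subseqs (T : Type) (s : seq T) : seq (seq T) :=
  if s is x :: s' then [seq x :: t | t <- subseqs s'] ++ subseqs s'
  else [:: [::]].

Lemma subseqs_map (T U : Type) (g : T -> U) (s : seq T) :
  subseqs (map g s) = map (map g) (subseqs s).
Proof.
elim: s => //= x s ->; rewrite map_cat -!map_comp; congr (_ ++ _).
Qed.

Lemma mem_subseqs (T : eqType) (s t : seq T) : (t \in subseqs s) = subseq t s.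
Proof.
elim: s t => [|x s IHs] t /=; first by case: t => [|y t]; rewrite inE.
rewrite mem_cat IHs; apply/orP/idP => [[/mapP[t' + ->]|ts]|].
- by rewrite IHs /= eqxx.
- exact: subseq_trans ts (subseq_cons _ _).
case: t => [|y t] /=; first by right; rewrite sub0seq.
case: eqP => [->|_ ts]; last by right.
by move=> ts; left; apply: map_f; rewrite IHs.
Qed.

Lemma subseqs_uniq (T : eqType) (s : seq T) : uniq s -> uniq (subseqs s).
Proof.
elim: s => //= x s IHs /andP[xs /IHs us]; rewrite cat_uniq us andbT.
rewrite map_inj_uniq ?us; last by move=> t t' [].
apply/hasPn => t; rewrite mem_subseqs => ts; apply/mapP => -[t' _ tE].
by move/negP: xs; apply; apply: (mem_subseq ts); rewrite tE mem_head.
Qed.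

Lemma sum_subseqs_cons (K : nmodType) (T : Type) x (s : seq T)
    (F : seq T -> K) :
  \sum_(t <- subseqs (x :: s)) F t = \sum_(t <- subseqs s) (F (x :: t) + F t).
Proof. by rewrite big_cat big_map big_split. Qed.

(** A strictly increasing sequence is determined by its set of members, so it is a filter of the
    enumeration. *)
Lemma subseq_enum_ord l (t : seq 'I_l) :
  subseq t (enum 'I_l) = sorted ltn [seq nat_of_ord k | k <- t].
Proof.
have lt_sorted : sorted ltn (map (@nat_of_ord l) (enum 'I_l)).
  by rewrite val_enum_ord iota_ltn_sorted.
apply/idP/idP => [/(map_subseq (@nat_of_ord l)) ts|st].
  by apply: (subseq_sorted ltn_trans ts).
rewrite sorted_map in st; rewrite sorted_map in lt_sorted.
have ltr : transitive (fun i j : 'I_l => (i < j)%N).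
  by move=> ? ? ?; exact: ltn_trans.
have tE : t = [seq k <- enum 'I_l | k \in t].
  apply: (irr_sorted_eq ltr) => //.
  - by move=> k; rewrite /= ltnn.
  - exact: sorted_filter.
  - by move=> k; rewrite mem_filter mem_enum andbT.
by rewrite tE filter_subseq.
Qed.

Lemma sum_subseqs_enum_ord (K : nmodType) l (F : seq 'I_l -> K) :
  \sum_(t <- subseqs (enum 'I_l)) F t =
  \sum_(0 <= m < l.+1)
    \sum_(j : m.-tuple 'I_l | sorted ltn [seq nat_of_ord k | k <- j]) F j.
Proof.
have size_le t : t \in subseqs (enum 'I_l) -> (size t < l.+1)%N.
  by rewrite mem_subseqs => /size_subseq; rewrite size_enum_ord.
rewrite big_mkord big_seq.
(* Sizes are at most [l], so [inord] never falls back to its default value. *)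
rewrite (partition_big (fun t => inord (size t) : 'I_l.+1) predT) //=.
apply: eq_bigr => m _.
rewrite -[in RHS]big_filter -[RHS](big_map val xpredT F) -big_filter.
rewrite -[LHS]big_filter -filter_predI; apply: perm_big; apply: uniq_perm.
- by rewrite filter_uniq // subseqs_uniq // enum_uniq.
- by rewrite map_inj_uniq ?filter_uniq ?index_enum_uniq //; exact: val_inj.
move=> t; rewrite mem_filter /=; apply/andP/mapP.
  case=> /andP[ts /eqP tm] _.
  have tE : size t = m by rewrite -tm inordK // size_le.
  exists (Tuple (introT eqP tE)) => //.
  by rewrite mem_filter mem_index_enum andbT /= -subseq_enum_ord -mem_subseqs.
move=> [j]; rewrite mem_filter mem_index_enum andbT -subseq_enum_ord.
rewrite -mem_subseqs => js ->; rewrite js; split=> //=.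
by apply/eqP/val_inj; rewrite /= inordK size_tuple.
Qed.

(** A selection from the tail, with product [c], either takes the new position, with factor [b - 1],
    or skips it. *)
Lemma shift_regroup (K : comPzRingType) (a b c x y : K) :
  c * (a * (x + (b - 1) * y)) = a * ((b - 1) * c * y + c * x).
Proof. by ring. Qed.

(** * Expansion along subwords and evaluation at $\psi^w$ *)

Section LocalizationFormula.
Variables (R : realType) (r : nat) (A : gcm r) (D : realization R A).

Local Notation W := (weyl D).
Local Notation s_ i := (sgen D i).
Local Notation wd := (word_weyl D).
Local Notation cox i j := (cox_order (- A i j) (- A j i)).
Local Notation act := (@weyl_act R r A D).
Local Notation root := (root_wt D).
Implicit Types (i j : 'I_r) (u v w : W) (x y : weight D) (f : W -> QT D).

(** For $u=1$ these are the $\beta_j$ paired with their letters, so one selection yields both the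
    product and the operator word. *)
Fixpoint inv_roots u (s : seq 'I_r) : seq (weight D * 'I_r) :=
  if s is i :: s' then (act u (root i), i) :: inv_roots (u * s_ i)%g s'
  else [::].

(** Induction on the word with a moving base point: [opD_shift] splits each term in two, and the
    factors $e^{u\alpha_i}=e^{u\rho-us_i\rho}$ telescope to the prefactor. *)
Lemma opD_expand f u s :
  f (u * wd s)%g = expwt (act u (rho D) - act (u * wd s)%g (rho D)) *
    \sum_(t <- subseqs (inv_roots u s))
      (\prod_(p <- t) (expwt (- p.1) - 1)) *
      foldr (@opD _ _ _ D) f [seq p.2 | p <- t] u.
Proof.
elim: s u => [|i s IHs] u.
  by rewrite word_weyl_nil mulg1 subrr expwt0 big_seq1 big_nil !mul1r.
rewrite word_weyl_cons mulgA IHs [inv_roots _ _]/=.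
have expE z : expwt (act u (rho D) - z) =
    expwt (act (u * s_ i)%g (rho D) - z) * expwt (act u (root i)).
  rewrite -expwtD; congr expwt.
  by rewrite weyl_actM weyl_act_sgen_rho weyl_actD weyl_actN addrAC subrK.
rewrite expE -mulrA; congr (_ * _).
rewrite sum_subseqs_cons mulr_sumr.
apply: eq_bigr => t _; rewrite opD_shift big_cons map_cons.
exact: shift_regroup.
Qed.

Lemma inv_roots_tuple l (i : l.-tuple 'I_r) u : inv_roots u i =
  [seq (act (u * wd (take k i))%g (root (tnth i k)), tnth i k)
  | k : 'I_l <- enum 'I_l].
Proof.
elim: l i u => [|l IHl] i u.
  by rewrite tuple0 /=; case: (enum _) (size_enum_ord 0).
case/tupleP: i => x i; rewrite /= IHl enum_ordSl /= word_weyl_nil mulg1 tnth0.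
congr (_ :: _); rewrite -map_comp; apply: eq_map => k /=.
by rewrite tnthS word_weyl_cons mulgA.
Qed.

Lemma prod_dgen s : (\prod_(k <- s) dgen D k)%g = dem_class D s.
Proof.
elim: s => [|i s IHs]; first by rewrite big_nil.
by rewrite big_cons IHs; exact: dem_classM.
Qed.

Section Psi.
Variable psi : W -> W -> QT D.
Hypothesis psiP : is_psi psi.

Lemma opD_psi w s :
  foldr (@opD _ _ _ D) (psi w) s 1%g =
    (dem_class D s == dem_weyl w)%:R /\
  (dem_class D s == dem_weyl w -> (len w <= size s)%N).
Proof.
have [_ psi1] := psiP w.
have [u su lu] := dem_cong_redword D s.
have uE : foldr (@opD _ _ _ D) (psi w) s 1%g = (u == w)%:R.
  by rewrite -psi1 (dem_cong_opD su).
have -> : (dem_class D s == dem_weyl w) = (u == w).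
  apply/eqP/eqP => [|uw]; last first.
    by rewrite /dem_weyl prod_dgen; apply/dem_classP; rewrite -uw.
  rewrite /dem_weyl prod_dgen => /dem_classP sw.
  (* The function $\psi^w$ itself separates the classes: congruent words give it the same value at
     the identity, so $\delta_{u,w}=1$. *)
  have : (u == w)%:R = 1 :> QT D.
    rewrite -uE (dem_cong_opD sw); apply: etrans (psi1 w) _.
    by rewrite eqxx.
  by case: eqP => // _ /eqP; rewrite eq_sym oner_eq0.
split; first exact: uE.
by move=> /eqP uw; rewrite -uw; exact: lu.
Qed.

End Psi.

End LocalizationFormula.

Theorem mainTheorem11 (R : realType) (r : nat) (A : gcm r)
    (D : realization R A) (psi : weyl D -> weyl D -> QT D)
    (psiP : is_psi psi) (v w : weyl D) (l : nat) (i : l.-tuple 'I_r)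
    (vE : v = (\prod_(k < l) sgen D (tnth i k))%g) (le_wv : bruhat w v) :
  psi w v =
    expwt (rho D - weyl_act v (rho D)) *
    \sum_(len w <= m < l.+1)
      \sum_(j : m.-tuple 'I_l |
              sorted ltn [seq nat_of_ord k | k <- j] &&
              ((\prod_(k < m) dgen D (tnth i (tnth j k)))%g == dem_weyl w))
        \prod_(k < m) (expwt (- beta D i (tnth j k)) - 1).
Proof.
have {vE}-> : v = (1 * word_weyl D i)%g.
  by rewrite mul1g vE /word_weyl [RHS]big_tuple.
rewrite opD_expand weyl_act1; congr (_ * _).
rewrite inv_roots_tuple subseqs_map big_map sum_subseqs_enum_ord.
(* The outer sum is extended to all $m\ge 0$, with the value 0 for $m<l(w)$. *)
rewrite [RHS](big_nat_widenl _ 0%N) // [RHS]big_mkcond.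
apply: eq_bigr => m _.
have prodE (j : m.-tuple 'I_l) :
    (\prod_(k < m) dgen D (tnth i (tnth j k)))%g =
    dem_class D [seq tnth i k | k <- j].
  by rewrite -prod_dgen big_map [RHS]big_tuple.
rewrite [X in if _ then X else _]big_mkcondr.
set e := fun k : 'I_l => _ : weight D * 'I_r.
have wordE (j : m.-tuple 'I_l) :
    [seq p.2 | p <- map e j] = [seq tnth i k | k <- j].
  by rewrite -map_comp.
transitivity (\sum_(j : m.-tuple 'I_l | sorted ltn [seq nat_of_ord k | k <- j])
   if (\prod_(k < m) dgen D (tnth i (tnth j k)))%g == dem_weyl w
   then \prod_(k < m) (expwt (- beta D i (tnth j k)) - 1) else 0).
  apply: eq_bigr => j _; rewrite wordE (opD_psi psiP w _).1 prodE.
  case: ifP => _; last by rewrite mulr0.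
  rewrite mulr1 big_map [LHS]big_tuple; apply: eq_bigr => k _.
  by rewrite /e mul1g.
(* A word shorter than $l(w)$ cannot have class $\underline w$, so the added terms vanish. *)
case: ifP => // /negbT lt_m; rewrite big1 // => j _.
case: ifP => //; rewrite prodE => /(opD_psi psiP w _).2.
by rewrite size_map size_tuple => le_m; rewrite le_m in lt_m.
Qed.
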